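(* Let $\alpha_0,\dots,\alpha_4$ be complex parameters with $\alpha_0+\alpha_1+\alpha_2+\alpha_3+\alpha_4=\frac12$, and consider the system \begin{align*} \frac{dx}{dt}&=\frac{2x^2y}{t}-x^2-\frac{2(\alpha_2+\alpha_3+\alpha_4)x}{t}+\frac1t+\frac{2z(zw+\alpha_3)}{t},\\ \frac{dy}{dt}&=-\frac{2xy^2}{t}+2xy+\frac{2(\alpha_2+\alpha_3+\alpha_4)y}{t}+\alpha_1,\\ \frac{dz}{dt}&=\frac{2z^2w}{t}-z^2-\frac{2\alpha_4z}{t}+\frac1t+\frac{2yz^2}{t},\\ \frac{dw}{dt}&=-\frac{2zw^2}{t}+2zw+\frac{2\alpha_4w}{t}+\alpha_3-\frac{2y(2zw+\alpha_3)}{t}. \end{align*} This system admits extended affine Weyl group symmetry of type $D_5^{(2)}$ as a group of Bäcklund transformations, with generators acting on $(x,y,z,w,t;\alpha_0,\dots,\alpha_4)$ by \begin{align*} s_0:&\ \to (x,y-t,z,w,-t;-\alpha_0,\alpha_1+2\alpha_0,\alpha_2,\alpha_3,\alpha_4),\\ s_1:&\ \to \left(x+\tfrac{\alpha_1}{y},y,z,w,t;\alpha_0+\alpha_1,-\alpha_1,\alpha_2+\alpha_1,\alpha_3,\alpha_4\right),\\ s_2:&\ \to \left(x,y-\tfrac{\alpha_2}{x-z},z,w+\tfrac{\alpha_2}{x-z},t;\alpha_0,\alpha_1+\alpha_2,-\alpha_2,\alpha_3+\alpha_2,\alpha_4\right),\\ s_3:&\ \to \left(x,y,z+\tfrac{\alpha_3}{w},w,t;\alpha_0,\alpha_1,\alpha_2+\alpha_3,-\alpha_3,\alpha_4+\alpha_3\right),\\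 s_4:&\ \to \left(-x,-y,-z,-w+\tfrac{2\alpha_4}{z}-\tfrac{1}{z^2},-t;\alpha_0,\alpha_1,\alpha_2,\alpha_3+2\alpha_4,-\alpha_4\right),\\ \pi:&\ \to \left(\tfrac{1}{tz},-t(zw+\alpha_3)z,\tfrac{1}{tx},-t(xy+\alpha_1)x,t;\alpha_4,\alpha_3,\alpha_2,\alpha_1,\alpha_0\right). \end{align*} That is: each of $s_0,\dots,s_4,\pi$ is a Bäcklund transformation of the system; the group generated by $s_0,\dots,s_4$ is the affine Weyl group of type $D_5^{(2)}$ with these as simple reflections (defining relations $s_i^2=1$; $(s_0s_1)^4=(s_3s_4)^4=1$; $(s_1s_2)^3=(s_2s_3)^3=1$; all other pairs commute); and $\pi$ realizes the diagram automorphism: $\pi^2=1$, $\pi s_i=s_{4-i}\pi$ for $i=0,\dots,4$.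
   Context: A transformation $(x,y,z,w,t;\alpha)\mapsto(x',y',z',w',t';\alpha')$, with $x',y',z',w',t'$ rational in $x,y,z,w,t,\alpha$, is a Bäcklund transformation of the system if, whenever $(x,y,z,w)(t)$ solves the system with parameters $\alpha$, the tuple $(x',y',z',w')$, viewed as a function of the independent variable $t'$ (where defined), solves the same system with parameters $\alpha'$. Such transformations are composed as automorphisms of the field of rational functions in $x,y,z,w,t$ and the parameters (subject to their linear relation): e.g. $s_1(x)=x+\alpha_1/y$, $s_1(\alpha_0)=\alpha_0+\alpha_1$. *)

(* Defs.v *)
From HB Require Import structures.
From mathcomp Require Import all_boot all_order all_algebra.
From mathcomp Require Import complex.
(* The notations of mpoly.v clash with those of MathComp-Analysis. *)
From mathcomp Require Import -(notations) mpoly.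
From mathcomp Require Import all_classical all_reals all_analysis.
Set Implicit Arguments.
Unset Strict Implicit.
Unset Printing Implicit Defensive.
Import Order.TTheory GRing.Theory Num.Theory numFieldNormedType.Exports.

Local Open Scope classical_set_scope.
Local Open Scope ring_scope.

(* Typing R[i] as a numFieldType selects its norm topology, so that [open] and
   [is_derive] below are those of the complex plane. *)
Definition Cplx (R : realType) : numFieldType := R[i].

(* Parameters (alpha_0, ..., alpha_4); alpha_i is written a`_i. *)
Definition admissible (R : realType) (a : 5.-tuple (Cplx R)) : Prop :=
  a`_0 + a`_1 + a`_2 + a`_3 + a`_4 = 2^-1.

Definition solution (R : realType) (a : 5.-tuple (Cplx R))
    (U : set (Cplx R)) (x y z w : Cplx R -> Cplx R) : Prop :=
  open U /\ forall t : Cplx R, U t ->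
  [/\ t != 0,
      is_derive t 1 x
        (2 * x t ^+ 2 * y t / t - x t ^+ 2
         - 2 * (a`_2 + a`_3 + a`_4) * x t / t + 1 / t
         + 2 * z t * (z t * w t + a`_3) / t),
      is_derive t 1 y
        (- (2 * x t * y t ^+ 2 / t) + 2 * x t * y t
         + 2 * (a`_2 + a`_3 + a`_4) * y t / t + a`_1),
      is_derive t 1 z
        (2 * z t ^+ 2 * w t / t - z t ^+ 2
         - 2 * a`_4 * z t / t + 1 / t + 2 * y t * z t ^+ 2 / t)
    & is_derive t 1 w
        (- (2 * z t * w t ^+ 2 / t) + 2 * z t * w t
         + 2 * a`_4 * w t / t + a`_3
         - 2 * y t * (2 * z t * w t + a`_3) / t)].

(* The field of rational functions in x, y, z, w, t and the parameters subject
   to their linear relation, presented as the fraction field of the polynomial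
   ring in x, y, z, w, t, alpha_1, ..., alpha_4 (variables 0 to 8 in this
   order), with alpha_0 = 1/2 - alpha_1 - alpha_2 - alpha_3 - alpha_4. *)
Definition ratfun (R : realType) : fieldType := {fraction (mpoly 9 (Cplx R))}.

Definition Kconst (R : realType) (c : Cplx R) : ratfun R :=
  tofrac (mpolyC 9 c).
Definition Kvar (R : realType) (k : 'I_9) : ratfun R :=
  tofrac (mpolyX (Cplx R) (mnm1 k)).

Definition Kx (R : realType) : ratfun R := Kvar R (@Ordinal 9 0 isT).
Definition Ky (R : realType) : ratfun R := Kvar R (@Ordinal 9 1 isT).
Definition Kz (R : realType) : ratfun R := Kvar R (@Ordinal 9 2 isT).
Definition Kw (R : realType) : ratfun R := Kvar R (@Ordinal 9 3 isT).
Definition Kt (R : realType) : ratfun R := Kvar R (@Ordinal 9 4 isT).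
Definition Ka (R : realType) : 5.-tuple (ratfun R) :=
  let a1 := Kvar R (@Ordinal 9 5 isT) in
  let a2 := Kvar R (@Ordinal 9 6 isT) in
  let a3 := Kvar R (@Ordinal 9 7 isT) in
  let a4 := Kvar R (@Ordinal 9 8 isT) in
  [tuple 2^-1 - (a1 + a2 + a3 + a4); a1; a2; a3; a4].

(* The coordinates of a point with admissible parameters; alpha_0 is omitted
   since it is determined by the others. *)
Definition point (R : realType) (x y z w t : Cplx R) (a : 5.-tuple (Cplx R)) :
    'I_9 -> Cplx R :=
  fun k => [:: x; y; z; w; t; a`_1; a`_2; a`_3; a`_4]`_k.

(* The rational function f is defined at p, with value v there. *)
Definition has_value (R : realType) (f : ratfun R) (p : 'I_9 -> Cplx R)
    (v : Cplx R) : Prop :=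
  exists n d : mpoly 9 (Cplx R),
    [/\ f = tofrac n / tofrac d, meval p d != 0 & v = meval p n / meval p d].

(* A transformation (x,y,z,w,t;alpha) |-> (x',y',z',w',t';alpha'), given by
   rational functions. *)
Record transformation (R : realType) := Transformation {
  tr_x : ratfun R;
  tr_y : ratfun R;
  tr_z : ratfun R;
  tr_w : ratfun R;
  tr_t : ratfun R;
  tr_a : 5.-tuple (ratfun R)
}.

(* V is a part of the domain of the given solution on which the transformed
   quantities are defined and on which t' = T(t) can serve as the independent
   variable; X, Y, Z, W are the transformed components as functions of t'.
   The new parameters a' depend on the old ones only. *)
Definition Backlund (R : realType) (s : transformation R) : Prop :=
  forall a : 5.-tuple (Cplx R), admissible a ->
  exists2 a' : 5.-tuple (Cplx R), admissible a' &
  forall (U : set (Cplx R)) (x y z w : Cplx R -> Cplx R),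
  solution a U x y z w ->
  forall (V : set (Cplx R)) (T X Y Z W : Cplx R -> Cplx R),
  open V -> V `<=` U -> {in V &, injective T} ->
  (forall t : Cplx R, V t ->
    let p := point (x t) (y t) (z t) (w t) t a in
    [/\ has_value (tr_t s) p (T t),
        has_value (tr_x s) p (X (T t)),
        has_value (tr_y s) p (Y (T t)),
        has_value (tr_z s) p (Z (T t))
      & has_value (tr_w s) p (W (T t))] /\
    (forall i : 'I_5, exists v, has_value (tr_a s)`_i p v)) ->
  (forall t : Cplx R, V t -> forall i : 'I_5,
    has_value (tr_a s)`_i (point (x t) (y t) (z t) (w t) t a) a'`_i) /\
  solution a' (T @` V) X Y Z W.

Definition tr_s0 (R : realType) : transformation R :=
  let: (x, y, z, w, t, a) := (Kx R, Ky R, Kz R, Kw R, Kt R, Ka R) in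
  Transformation x (y - t) z w (- t)
    [tuple - a`_0; a`_1 + 2 * a`_0; a`_2; a`_3; a`_4].

Definition tr_s1 (R : realType) : transformation R :=
  let: (x, y, z, w, t, a) := (Kx R, Ky R, Kz R, Kw R, Kt R, Ka R) in
  Transformation (x + a`_1 / y) y z w t
    [tuple a`_0 + a`_1; - a`_1; a`_2 + a`_1; a`_3; a`_4].

Definition tr_s2 (R : realType) : transformation R :=
  let: (x, y, z, w, t, a) := (Kx R, Ky R, Kz R, Kw R, Kt R, Ka R) in
  Transformation x (y - a`_2 / (x - z)) z (w + a`_2 / (x - z)) t
    [tuple a`_0; a`_1 + a`_2; - a`_2; a`_3 + a`_2; a`_4].

Definition tr_s3 (R : realType) : transformation R :=
  let: (x, y, z, w, t, a) := (Kx R, Ky R, Kz R, Kw R, Kt R, Ka R) in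
  Transformation x y (z + a`_3 / w) w t
    [tuple a`_0; a`_1; a`_2 + a`_3; - a`_3; a`_4 + a`_3].

Definition tr_s4 (R : realType) : transformation R :=
  let: (x, y, z, w, t, a) := (Kx R, Ky R, Kz R, Kw R, Kt R, Ka R) in
  Transformation (- x) (- y) (- z) (- w + 2 * a`_4 / z - 1 / z ^+ 2) (- t)
    [tuple a`_0; a`_1; a`_2; a`_3 + 2 * a`_4; - a`_4].

Definition tr_s (R : realType) (i : 'I_5) : transformation R :=
  tnth [tuple tr_s0 R; tr_s1 R; tr_s2 R; tr_s3 R; tr_s4 R] i.

Definition tr_pi (R : realType) : transformation R :=
  let: (x, y, z, w, t, a) := (Kx R, Ky R, Kz R, Kw R, Kt R, Ka R) in
  Transformation (1 / (t * z)) (- (t * (z * w + a`_3) * z))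
    (1 / (t * x)) (- (t * (x * y + a`_1) * x)) t
    [tuple a`_4; a`_3; a`_2; a`_1; a`_0].

(* f is the automorphism over the complex numbers substituting the
   transformation s; it is uniquely determined by s. *)
Definition automorphism_of (R : realType) (s : transformation R)
    (f : {rmorphism ratfun R -> ratfun R}) : Prop :=
  [/\ bijective f, (forall c : Cplx R, f (Kconst c) = Kconst c),
      [/\ f (Kx R) = tr_x s, f (Ky R) = tr_y s, f (Kz R) = tr_z s,
          f (Kw R) = tr_w s & f (Kt R) = tr_t s]
    & forall i : 'I_5, f (Ka R)`_i = (tr_a s)`_i].

(* The product of generators spelled by a word. *)
Definition word_act (R : realType)
    (S : 'I_5 -> {rmorphism ratfun R -> ratfun R}) (u : seq 'I_5) :
    ratfun R -> ratfun R :=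
  foldr (fun i (g : ratfun R -> ratfun R) => S i \o g) idfun u.

(* The Coxeter matrix of type D_5^(2):  0 =4= 1 --- 2 --- 3 =4= 4. *)
Definition D52_coxeter (i j : 'I_5) : nat :=
  if i == j then 1%N
  else if (i.+1 == j) || (j.+1 == i)
    then if minn i j \in [:: 0; 3]%N then 4%N else 3%N
  else 2%N.

(* Equality of words in the affine Weyl group of type D_5^(2), i.e. in the
   group presented by (s_i s_j)^(m_ij) = 1.  Words without inverses suffice,
   because each generator is its own inverse (m_ii = 1). *)
Inductive D52_eq : seq 'I_5 -> seq 'I_5 -> Prop :=
| D52_rel (i j : 'I_5) :
    D52_eq (flatten (nseq (D52_coxeter i j) [:: i; j])) [::]
| D52_refl (u : seq 'I_5) : D52_eq u u
| D52_sym (u v : seq 'I_5) : D52_eq u v -> D52_eq v u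
| D52_trans (u v w : seq 'I_5) : D52_eq u v -> D52_eq v w -> D52_eq u w
| D52_cat (u u' v v' : seq 'I_5) :
    D52_eq u u' -> D52_eq v v' -> D52_eq (u ++ v) (u' ++ v').

(* Main.v *)
(* Backlund property: on a solution the transformed quantities are explicit
   rational expressions in x, y, z, w, t, so the chain rule reduces the claim to
   identities of rational functions.  When a generator has a denominator, the
   given values force it to be nonzero: otherwise the numerator would vanish
   along a deformation of the point (moving a parameter) that keeps the
   denominator zero.

   Automorphisms: each transformation, seen as a point of affine space over the
   field K of rational functions, maps back to the generic point under itself.
   A polynomial vanishing at this point is therefore zero, so substitution
   extends to an involutive endomorphism of K.  The Coxeter and diagram relations
   are then identities between the images of the nine variables.

   Faithfulness: s_i maps alpha_j to alpha_j + n_ij alpha_i and alpha_i to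
   - alpha_i, and the alpha_j are linearly independent, so this is the geometric
   representation.  By Tits' argument a reduced word u i sends alpha_i to a
   negative combination of simple roots; hence only the trivial element of the
   abstract Coxeter group acts trivially. *)
Require Import Defs.
From HB Require Import structures.
From mathcomp Require Import all_boot all_order all_algebra zify ring.
From mathcomp Require Import complex.
From mathcomp Require Import -(notations) mpoly.
From mathcomp Require Import all_classical all_reals all_analysis.
Import GRing.Theory Num.Theory.
Set Implicit Arguments.
Unset Strict Implicit.
Unset Printing Implicit Defensive.
Local Open Scope ring_scope.

(** * Values of rational functions at points over an extension field *)

Section FractionValue.
Variables (n : nat) (C L : fieldType) (phi : {rmorphism C -> L}) (p : 'I_n -> L).
Local Notation K := {fraction (mpoly n C)}.
Implicit Types (f g : K) (u v : L).

(** For [phi = idfun] over the complex numbers this is [has_value]. A general [L] also admits points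
    whose coordinates are rational functions, where taking a value is substitution. *)
Definition fvalue f v : Prop :=
  exists a b : mpoly n C,
    [/\ f = tofrac a / tofrac b, mmap phi p b != 0
      & v = mmap phi p a / mmap phi p b].

Lemma mmap_neq0 (a : mpoly n C) : mmap phi p a != 0 -> a != 0.
Proof. by apply: contra_neq => ->; rewrite rmorph0. Qed.

Lemma fvalue_inj f u v : fvalue f u -> fvalue f v -> u = v.
Proof.
move=> [a [b [-> b0 ->]]] [c [d [/eqP + d0 ->]]].
rewrite eqr_div ?tofrac_eq0 ?mmap_neq0 // -!tofracM tofrac_eq => /eqP e.
by apply/eqP; rewrite eqr_div // -!rmorphM e.
Qed.

Lemma fvalue_tofrac (a : mpoly n C) : fvalue (tofrac a) (mmap phi p a).
Proof. by exists a, 1; rewrite !rmorph1 !divr1 oner_neq0. Qed.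

Lemma fvalueC (c : C) : fvalue (tofrac (mpolyC n c)) (phi c).
Proof. by rewrite -[phi c](@mmapC _ _ _ p phi); apply: fvalue_tofrac. Qed.

Lemma fvalueX k : fvalue (tofrac (mpolyX C (mnm1 k))) (p k).
Proof. by rewrite -[p k](mmap1U p k) -(mmapX p phi); apply: fvalue_tofrac. Qed.

Lemma fvalue0 : fvalue 0 0.
Proof. by have := fvalue_tofrac 0; rewrite !rmorph0. Qed.

Lemma fvalue1 : fvalue 1 1.
Proof. by have := fvalue_tofrac 1; rewrite !rmorph1. Qed.

Lemma fvalueD f g u v : fvalue f u -> fvalue g v -> fvalue (f + g) (u + v).
Proof.
move=> [a [b [-> b0 ->]]] [c [d [-> d0 ->]]].
exists (a * d + c * b), (b * d).
rewrite !tofracD !tofracM !rmorphD !rmorphM /= mulf_neq0 //.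
by rewrite !addf_div ?tofrac_eq0 ?mmap_neq0.
Qed.

Lemma fvalueN f u : fvalue f u -> fvalue (- f) (- u).
Proof.
by move=> [a [b [-> b0 ->]]]; exists (- a), b; rewrite !rmorphN !mulNr.
Qed.

Lemma fvalueB f g u v : fvalue f u -> fvalue g v -> fvalue (f - g) (u - v).
Proof. by move=> fu /fvalueN; apply: fvalueD. Qed.

Lemma fvalueM f g u v : fvalue f u -> fvalue g v -> fvalue (f * g) (u * v).
Proof.
move=> [a [b [-> b0 ->]]] [c [d [-> d0 ->]]].
by exists (a * c), (b * d); rewrite !tofracM !rmorphM /= mulf_neq0 // !mulf_div.
Qed.

Lemma fvalueV f u : fvalue f u -> u != 0 -> fvalue f^-1 u^-1.
Proof.
move=> [a [b [-> b0 ->]]]; rewrite mulf_eq0 invr_eq0 negb_or => /andP[a0 _].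
by exists b, a; rewrite !invf_div.
Qed.

Lemma fvalue_div f g u v : fvalue f u -> fvalue g v -> v != 0 ->
  fvalue (f / g) (u / v).
Proof. by move=> fu gv v0; apply/(fvalueM fu)/fvalueV. Qed.

Lemma fvalueXn f u k : fvalue f u -> fvalue (f ^+ k) (u ^+ k).
Proof.
move=> fu; elim: k => [|k IH]; first exact: fvalue1.
by rewrite !exprS; apply: fvalueM.
Qed.

Lemma fvalueMn f u k : fvalue f u -> fvalue (f *+ k) (u *+ k).
Proof.
move=> fu; elim: k => [|k IH]; first exact: fvalue0.
by rewrite !mulrS; apply: fvalueD.
Qed.

Lemma fvalue_nat k : fvalue k%:R k%:R.
Proof. exact/fvalueMn/fvalue1. Qed.

Section Pole.
Variable P : 'I_n -> {poly L}.
Local Notation ev := (mmap ((polyC \o phi) : {rmorphism C -> {poly L}}) P).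

(** Restriction of a polynomial to the curve [P]; the indeterminate of [{poly L}] is the parameter
    of the curve, and by [Pp] its value 0 gives [p]. *)
Definition pvalue f (q : {poly L}) : Prop :=
  exists2 a : mpoly n C, f = tofrac a & ev a = q.

Lemma pvalueX k : pvalue (tofrac (mpolyX C (mnm1 k))) (P k).
Proof. by exists (mpolyX C (mnm1 k)); rewrite ?mmapX ?mmap1U. Qed.

Lemma pvalue1 : pvalue 1 1.
Proof. by exists 1; rewrite ?rmorph1. Qed.

Lemma pvalue_nat k : pvalue k%:R k%:R.
Proof. by exists k%:R; rewrite ?rmorph_nat. Qed.

Lemma pvalueD f g q r : pvalue f q -> pvalue g r -> pvalue (f + g) (q + r).
Proof. by move=> [a -> <-] [b -> <-]; exists (a + b); rewrite rmorphD. Qed.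

Lemma pvalueN f q : pvalue f q -> pvalue (- f) (- q).
Proof. by move=> [a -> <-]; exists (- a); rewrite rmorphN. Qed.

Lemma pvalueM f g q r : pvalue f q -> pvalue g r -> pvalue (f * g) (q * r).
Proof. by move=> [a -> <-] [b -> <-]; exists (a * b); rewrite rmorphM. Qed.

Hypothesis Pp : forall k, (P k).[0] = p k.

(* P is a deformation of p along which the denominator g of f = h / g vanishes
   identically, while its numerator h is generically nonzero. *)
Lemma fvalue_pole f g h v q :
  pvalue g 0 -> pvalue h q -> q != 0 -> f * g = h -> ~ fvalue f v.
Proof.
move=> [g' -> g0] [h' -> hq] q0 fg [a [b [fE b0 _]]].
have ev0 (c : mpoly n C) : (ev c).[0] = mmap phi p c.
  rewrite /mmap horner_sum; apply: eq_bigr => m _.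
  rewrite !hornerE; congr (_ * _); rewrite /mmap1 horner_prod.
  by apply: eq_bigr => k _; rewrite horner_exp Pp.
(* Along [P] the left side vanishes and [h'] does not, so [b] vanishes on all of [P], against [b0]
   at [p]. *)
have /eqP : tofrac (a * g') = tofrac (h' * b) :> K.
  rewrite !rmorphM /= -fg fE -mulrA [_ * tofrac b]mulrC !mulrA.
  by rewrite mulfVK ?tofrac_eq0 ?mmap_neq0 // mulrC.
rewrite tofrac_eq => /eqP/(congr1 ev); rewrite !rmorphM /= g0 mulr0 hq.
move/esym/eqP; rewrite mulf_eq0 (negPf q0) /= => /eqP/(congr1 (fun r => r.[0])).
by rewrite ev0 horner0 => /eqP; rewrite (negPf b0).
Qed.
End Pole.
End FractionValue.

(** * Substitution endomorphisms of a field of fractions *)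

Lemma fraction_quotient (R : idomainType) (f : {fraction R}) :
  exists a b : R, b != 0 /\ f = tofrac a / tofrac b.
Proof.
elim/quotW: f => r; exists (frac r).1, (frac r).2; split; first exact: denom_ratioP.
apply: (@mulIf _ (tofrac (frac r).2)); first by rewrite tofrac_eq0 denom_ratioP.
rewrite mulfVK ?tofrac_eq0 ?denom_ratioP //.
unlock FracField.tofrac; rewrite -[LHS]FracField.pi_mul; apply/eqmodP.
rewrite /= FracField.equivfE /FracField.mulf.
by rewrite !numden_Ratio ?mulf_neq0 ?oner_neq0 ?denom_ratioP // !mulr1 mulrC.
Qed.

Section FractionMorphism.
Variables (n : nat) (C : fieldType).
Local Notation K := {fraction (mpoly n C)}.
Local Notation const c := (tofrac (mpolyC n c)).
Local Notation var k := (tofrac (mpolyX C (mnm1 k))).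

Lemma fraction_rmorph_eq (L : fieldType) (f g : {rmorphism K -> L}) :
  (forall c, f (const c) = g (const c)) -> (forall k, f (var k) = g (var k)) ->
  f =1 g.
Proof.
move=> fgC fgX; have fg_poly (a : mpoly n C) : f (tofrac a) = g (tofrac a).
  rewrite [a]mpolyE !rmorph_sum; apply: eq_bigr => m _.
  rewrite -mul_mpolyC !rmorphM /= fgC mpolyXE_id !rmorph_prod; congr (_ * _).
  by apply: eq_bigr => k _; rewrite !rmorphXn /= fgX.
by move=> F; have [a [b [_ ->]]] := fraction_quotient F; rewrite !fmorph_div !fg_poly.
Qed.

(** The hypothesis says that substituting [q] into itself returns the generic point. This one check
    shows both that substitution is defined on every fraction and that it is its own inverse. *)
Lemma fraction_involution (q : 'I_n -> K) :
    (forall k, @fvalue n C K (@tofrac _ \o @mpolyC n C) q (q k) (var k)) ->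
  exists f : {rmorphism K -> K},
    [/\ forall c, f (const c) = const c, forall k, f (var k) = q k
      & forall x, f (f x) = x].
Proof.
set phi : {rmorphism C -> K} := (X in fvalue X) => qq.
(* Substituting twice is the identity on polynomials. *)
have qq_poly (a : mpoly n C) : fvalue phi q (mmap phi q a) (tofrac a).
  rewrite {1}/mmap.
  have -> : tofrac a = \sum_(m <- msupp a) phi (mcoeff m a) * tofrac (mpolyX C m).
    rewrite {1}[a]mpolyE rmorph_sum; apply: eq_bigr => m _.
    by rewrite -mul_mpolyC rmorphM.
  elim: (msupp a) => [|m s IH]; first by rewrite !big_nil; apply: fvalue0.
  rewrite !big_cons; apply: fvalueD IH; apply: fvalueM; first exact: fvalueC.
  rewrite /mmap1 mpolyXE_id rmorph_prod.
  elim: (index_enum _) => [|k r IH]; first by rewrite !big_nil; apply: fvalue1.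
  by rewrite !big_cons rmorphXn; apply: fvalueM IH; apply: fvalueXn.
(* If [a] vanishes at [q], then 0 has both [a] and 0 as values there, so [a] is zero. Hence no
   denominator is killed. *)
have q_inj (a : mpoly n C) : a != 0 -> mmap phi q a != 0.
  apply: contra_neq => a0; apply/eqP; rewrite -tofrac_eq0; apply/eqP.
  by apply: (fvalue_inj (qq_poly a)); rewrite a0; apply: fvalue0.
(* Values now exist everywhere; their uniqueness makes the chosen function a ring morphism. *)
have /boolp.choice[f fP] x : exists v, fvalue phi q x v.
  have [a [b [b0 ->]]] := fraction_quotient x.
  by exists (mmap phi q a / mmap phi q b), a, b; split=> //; apply: q_inj.
have f_zmod : zmod_morphism f.
  by move=> x y; apply: (fvalue_inj (fP _)); apply: fvalueB.
have f_monoid : monoid_morphism f.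
  split; first exact: (fvalue_inj (fP 1) (fvalue1 _ _)).
  by move=> x y; apply: (fvalue_inj (fP _)); apply: fvalueM.
pose fA := GRing.isZmodMorphism.Build K K f f_zmod.
pose fM := GRing.isMonoidMorphism.Build K K f f_monoid.
pose F : {rmorphism K -> K} := HB.pack f fA fM.
have F_const c : F (const c) = const c := fvalue_inj (fP _) (fvalueC phi q c).
have F_var k : F (var k) = q k := fvalue_inj (fP _) (fvalueX phi q k).
exists F; split=> //.
apply: (fraction_rmorph_eq (f := F \o F) (g := idfun)) => [c|k].
  exact: etrans (congr1 F (F_const c)) (F_const c).
exact: etrans (congr1 F (F_var k)) (fvalue_inj (fP _) (qq k)).
Qed.
End FractionMorphism.

(** * The generators as automorphisms *)

Lemma fvalue_eq n (C L : fieldType) (phi : {rmorphism C -> L}) (p : 'I_n -> L)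
  f u v : fvalue phi p f u -> u = v -> fvalue phi p f v.
Proof. by move=> fu <-. Qed.

(** The list of [point], over any [nmodType]: the entries may be complex numbers, rational functions
    or polynomials along a deformation. *)
Definition coordinates (V : nmodType) (x y z w t a1 a2 a3 a4 : V) : 'I_9 -> V :=
  fun k => [:: x; y; z; w; t; a1; a2; a3; a4]`_k.

Section Point.
Variables (R : realType) (L : fieldType) (phi : {rmorphism Cplx R -> L}).
Variables (x y z w t a1 a2 a3 a4 : L).
Implicit Type f : ratfun R.

Local Notation p := (coordinates x y z w t a1 a2 a3 a4).
Local Notation value := (@fvalue 9 (Cplx R) L phi p).

Lemma value_Kx : value (Kx R) x. Proof. exact: fvalueX. Qed.
Lemma value_Ky : value (Ky R) y. Proof. exact: fvalueX. Qed.
Lemma value_Kz : value (Kz R) z. Proof. exact: fvalueX. Qed.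
Lemma value_Kw : value (Kw R) w. Proof. exact: fvalueX. Qed.
Lemma value_Kt : value (Kt R) t. Proof. exact: fvalueX. Qed.
Lemma value_Ka1 : value (Ka R)`_1 a1. Proof. exact: fvalueX. Qed.
Lemma value_Ka2 : value (Ka R)`_2 a2. Proof. exact: fvalueX. Qed.
Lemma value_Ka3 : value (Ka R)`_3 a3. Proof. exact: fvalueX. Qed.
Lemma value_Ka4 : value (Ka R)`_4 a4. Proof. exact: fvalueX. Qed.

Lemma value_Ka0 : value (Ka R)`_0 (2^-1 - (a1 + a2 + a3 + a4)).
Proof.
have -> : (Ka R)`_0 =
  2^-1 - ((Ka R)`_1 + (Ka R)`_2 + (Ka R)`_3 + (Ka R)`_4) by [].
apply: fvalueB; last first.
  exact: fvalueD (fvalueD (fvalueD value_Ka1 value_Ka2) value_Ka3) value_Ka4.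
pose emb : {rmorphism Cplx R -> ratfun R} := @tofrac _ \o @mpolyC 9 (Cplx R).
have -> : 2^-1 = emb 2^-1 :> ratfun R by rewrite fmorphV rmorph_nat.
by apply: fvalue_eq (fvalueC phi p 2^-1) _; rewrite fmorphV rmorph_nat.
Qed.
End Point.

(** Subtraction is tried before addition and division before multiplication, since the former unfold
    to the latter. Nonvanishing of denominators is left as a goal. *)
Ltac fvalue_step :=
  lazymatch goal with
  | |- fvalue _ _ (_ - _) _ => eapply fvalueB
  | |- fvalue _ _ (_ + _) _ => eapply fvalueD
  | |- fvalue _ _ (- _) _ => eapply fvalueN
  | |- fvalue _ _ (_ / _) _ => eapply fvalue_div
  | |- fvalue _ _ (_ * _) _ => eapply fvalueM
  | |- fvalue _ _ (_ ^+ _) _ => eapply fvalueXn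
  | |- fvalue _ _ 1 _ => eapply fvalue1
  | |- fvalue _ _ (_%:R) _ => eapply fvalue_nat
  | |- fvalue _ _ (Kx _) _ => eapply value_Kx
  | |- fvalue _ _ (Ky _) _ => eapply value_Ky
  | |- fvalue _ _ (Kz _) _ => eapply value_Kz
  | |- fvalue _ _ (Kw _) _ => eapply value_Kw
  | |- fvalue _ _ (Kt _) _ => eapply value_Kt
  | |- fvalue _ _ (tval (Ka _))`_0 _ => eapply value_Ka0
  | |- fvalue _ _ (tval (Ka _))`_1 _ => eapply value_Ka1
  | |- fvalue _ _ (tval (Ka _))`_2 _ => eapply value_Ka2
  | |- fvalue _ _ (tval (Ka _))`_3 _ => eapply value_Ka3
  | |- fvalue _ _ (tval (Ka _))`_4 _ => eapply value_Ka4
  end.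
Ltac fvalue_auto := eapply fvalue_eq; [repeat fvalue_step|].

Lemma fvalue_neq0 n (C L : fieldType) (phi : {rmorphism C -> L}) (p : 'I_n -> L)
  f v : fvalue phi p f v -> v != 0 -> f != 0.
Proof.
move=> fv; apply: contra_neq => f0; rewrite f0 in fv.
exact: (fvalue_inj fv (fvalue0 phi p)).
Qed.

Section Concrete.
Variable R : realType.

Let emb : {rmorphism Cplx R -> ratfun R} := @tofrac _ \o @mpolyC 9 (Cplx R).

(** This element and the next ones are nonzero because each takes the value 1 at some point. *)
Lemma Kx_neq0 : Kx R != 0.
Proof. by apply: (fvalue_neq0 (value_Kx idfun 1 0 0 0 0 0 0 0 0)); exact: oner_neq0. Qed.
Lemma Ky_neq0 : Ky R != 0.
Proof. by apply: (fvalue_neq0 (value_Ky idfun 0 1 0 0 0 0 0 0 0)); exact: oner_neq0. Qed.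
Lemma Kz_neq0 : Kz R != 0.
Proof. by apply: (fvalue_neq0 (value_Kz idfun 0 0 1 0 0 0 0 0 0)); exact: oner_neq0. Qed.
Lemma Kw_neq0 : Kw R != 0.
Proof. by apply: (fvalue_neq0 (value_Kw idfun 0 0 0 1 0 0 0 0 0)); exact: oner_neq0. Qed.
Lemma Kt_neq0 : Kt R != 0.
Proof. by apply: (fvalue_neq0 (value_Kt idfun 0 0 0 0 1 0 0 0 0)); exact: oner_neq0. Qed.
Lemma KxBz_neq0 : Kx R - Kz R != 0.
Proof.
apply: (@fvalue_neq0 _ _ _ idfun (coordinates 1 0 0 0 0 0 0 0 0) _ 1).
  by fvalue_auto; rewrite subr0.
exact: oner_neq0.
Qed.

(** The sum is evaluated where [alpha_j] is 1/2 and the other parameters vanish, a choice compatible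
    with the linear relation; its value there is half of [c j]. *)
Lemma Ka_free (c : 'I_5 -> nat) :
  \sum_(j < 5) (Ka R)`_j *+ c j = 0 -> forall j, c j = 0%N.
Proof.
move=> c0 j.
pose e (k : nat) : Cplx R := if k == j then 2^-1 else 0.
pose p := coordinates 0 0 0 0 0 (e 1%N) (e 2%N) (e 3%N) (e 4%N).
have Ke : forall i : 'I_5, fvalue idfun p (Ka R)`_i (e i).
  have e0 : 2^-1 - (e 1%N + e 2%N + e 3%N + e 4%N) = e 0%N.
    rewrite /e; case: j @e @p => [[|[|[|[|[|//]]]]] ?] /=;
      by rewrite ?add0r ?addr0 ?subrr ?subr0.
  case=> [[|[|[|[|[|//]]]]] ?].
  - exact: fvalue_eq (value_Ka0 _ _ _ _ _ _ _ _ _ _) e0.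
  - exact: value_Ka1.
  - exact: value_Ka2.
  - exact: value_Ka3.
  - exact: value_Ka4.
have : fvalue idfun p (\sum_(j < 5) (Ka R)`_j *+ c j) (\sum_(i < 5) e i *+ c i).
  elim: (index_enum _) => [|k r IH]; first by rewrite !big_nil; apply: fvalue0.
  rewrite !big_cons; apply: fvalueD IH.
  exact/fvalueMn/Ke.
rewrite c0 => /(fvalue_inj (fvalue0 _ _)) /esym.
rewrite (bigD1 j) //= big1 ?addr0 => [|i /negPf ij]; last first.
  by rewrite /e val_eqE ij mul0rn.
move/eqP; rewrite /e eqxx mulrn_eq0 invr_eq0 pnatr_eq0 orbF.
by move/eqP.
Qed.

Lemma Ka0E :
  (Ka R)`_0 = 2^-1 - ((Ka R)`_1 + (Ka R)`_2 + (Ka R)`_3 + (Ka R)`_4).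
Proof. by []. Qed.

(** Only the nine independent coordinates are checked; the image of [alpha_0] follows from the
    linear relation. *)
Lemma transformation_involution (X Y Z W T A0 A1 A2 A3 A4 : ratfun R) :
    let value := fvalue emb (coordinates X Y Z W T A1 A2 A3 A4) in
    A0 = 2^-1 - (A1 + A2 + A3 + A4) ->
    [/\ value X (Kx R), value Y (Ky R), value Z (Kz R), value W (Kw R)
      & value T (Kt R)] ->
    [/\ value A1 (Ka R)`_1, value A2 (Ka R)`_2, value A3 (Ka R)`_3
      & value A4 (Ka R)`_4] ->
  exists f : {rmorphism ratfun R -> ratfun R},
    automorphism_of (Transformation X Y Z W T [tuple A0; A1; A2; A3; A4]) f /\
    forall x, f (f x) = x.
Proof.
move=> value A0E [sx sy sz sw st] [s1 s2 s3 s4].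
have [|f [fC fX fK]] := @fraction_involution 9 (Cplx R)
    (coordinates X Y Z W T A1 A2 A3 A4).
  (* The variables are defined with the bound proof [isT]; this makes the ordinals coincide
     syntactically. *)
  by case=> [[|[|[|[|[|[|[|[|[|//]]]]]]]]] i]; rewrite (bool_irrelevance i isT).
exists f; split=> //; split=> //.
- by exists f.
- by split; apply: fX.
case=> [[|[|[|[|[|//]]]]] i]; try exact: fX.
rewrite [nat_of_ord _]/= Ka0E !rmorphB !rmorphD fmorphV rmorph_nat !fX.
by rewrite A0E.
Qed.
End Concrete.

(** Passes to an arbitrary field, carrying the nonvanishing facts along, so that [field] sees the
    generators as atoms. *)
Ltac generalize_generators R :=
  move: (Kx_neq0 R) (Ky_neq0 R) (Kz_neq0 R) (Kw_neq0 R) (Kt_neq0 R) (KxBz_neq0 R);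
  move: (Kx R) (Ky R) (Kz R) (Kw R) (Kt R);
  move: ((Ka R)`_1) ((Ka R)`_2) ((Ka R)`_3) ((Ka R)`_4);
  move: (ratfun R).
Ltac rewrite_neq0 :=
  repeat match goal with
  | H : is_true (_ != 0) |- _ => rewrite ?(negPf H) //; clear H
  end.
Ltac involution_tac R :=
  apply: transformation_involution;
  [rewrite ?Ka0E|split; fvalue_auto; rewrite ?Ka0E|split; fvalue_auto; rewrite ?Ka0E];
  try by []; generalize_generators R => K ? ? ? ? x y z w t x0 y0 z0 w0 t0 xz0;
  first [by []|ring|field|idtac];
  rewrite ?(div1r, mulf_eq0, invr_eq0, oppr_eq0, expf_eq0, oner_eq0);
  rewrite_neq0.

Lemma involution_s (R : realType) (i : 'I_5) :
  exists f : {rmorphism ratfun R -> ratfun R},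
    automorphism_of (tr_s R i) f /\ forall x, f (f x) = x.
Proof.
case: i => [[|[|[|[|[|//]]]]] ?]; rewrite /tr_s (tnth_nth (tr_s0 R)) [nth _ _ _]/=;
  involution_tac R.
Qed.

Lemma involution_pi (R : realType) : exists f : {rmorphism ratfun R -> ratfun R},
  automorphism_of (tr_pi R) f /\ forall x, f (f x) = x.
Proof. involution_tac R. Qed.

(** * Relations *)

Section Relations.
Variables (K : fieldType) (x y z w t a0 a1 a2 a3 a4 : K).
Implicit Type f g : {rmorphism K -> K}.

(** A product of equations instead of a conjunction, so that it serves as a multirule for
    [rewrite]. *)
Definition images f (X Y Z W T A0 A1 A2 A3 A4 : K) : Prop :=
  (((f x = X) * (f y = Y) * (f z = Z) * (f w = W) * (f t = T)) *
   ((f a0 = A0) * (f a1 = A1) * (f a2 = A2) * (f a3 = A3) * (f a4 = A4)))%type.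

Definition agree (f g : K -> K) : Prop :=
  [/\ f x = g x, f y = g y, f z = g z, f w = g w & f t = g t] /\
  [/\ f a1 = g a1, f a2 = g a2, f a3 = g a3 & f a4 = g a4].

Hypotheses (x0 : x != 0) (y0 : y != 0) (z0 : z != 0) (w0 : w != 0) (t0 : t != 0)
  (xz0 : x - z != 0).

Variables s0 s1 s2 s3 s4 p : {rmorphism K -> K}.
Hypothesis E0 : images s0 x (y - t) z w (- t) (- a0) (a1 + 2 * a0) a2 a3 a4.
Hypothesis E1 :
  images s1 (x + a1 / y) y z w t (a0 + a1) (- a1) (a2 + a1) a3 a4.
Hypothesis E2 :
  images s2 x (y - a2 / (x - z)) z (w + a2 / (x - z)) t
    a0 (a1 + a2) (- a2) (a3 + a2) a4.
Hypothesis E3 :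
  images s3 x y (z + a3 / w) w t a0 a1 (a2 + a3) (- a3) (a4 + a3).
Hypothesis E4 :
  images s4 (- x) (- y) (- z) (- w + 2 * a4 / z - 1 / z ^+ 2) (- t)
    a0 a1 a2 (a3 + 2 * a4) (- a4).
Hypothesis Ep :
  images p (1 / (t * z)) (- (t * (z * w + a3) * z)) (1 / (t * x))
    (- (t * (x * y + a1) * x)) t a4 a3 a2 a1 a0.

Lemma numerator_neq0 (u n d : K) : u != 0 -> d != 0 -> u = n / d -> n != 0.
Proof. by move=> u0 d0 E; apply: contra_neq u0 => n0; rewrite E n0 mul0r. Qed.

Ltac apply_images :=
  rewrite /= ?(E0, E1, E2, E3, E4, Ep, rmorphD, rmorphN, rmorphM, fmorphV,
               rmorphXn, rmorph1, rmorph_nat).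
Ltac nonzero := rewrite -?opprD ?oppr_eq0 ?oner_eq0.
Ltac agree_tac :=
  split; split; apply_images; first [by []|ring|field|idtac]; nonzero => //;
  repeat (apply/andP; split); rewrite ?mulf_neq0 ?oppr_eq0 //.

(* The denominators below are, up to nonzero factors, images of nonzero elements
   under products of the generators; they have the shape in which [field]
   returns them. *)
Let y2_neq0 : y * (x - z) - a2 != 0.
Proof.
apply: (@numerator_neq0 (s2 y) _ (x - z)) => //; first by rewrite fmorph_eq0.
by apply_images; field.
Qed.

Let xz1_neq0 : x * y + a1 + - z * y != 0.
Proof.
apply: (@numerator_neq0 (s1 (x - z)) _ y) => //; first by rewrite fmorph_eq0.
by apply_images; field.
Qed.

Let w2_neq0 : w * (x - z) + a2 != 0.
Proof.
apply: (@numerator_neq0 (s2 w) _ (x - z)) => //; first by rewrite fmorph_eq0.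
by apply_images; field.
Qed.

Let xz3_neq0 : x * w - (z * w + a3) != 0.
Proof.
apply: (@numerator_neq0 (s3 (x - z)) _ w) => //; first by rewrite fmorph_eq0.
by apply_images; field.
Qed.

Let z3_neq0 : z * w + a3 != 0.
Proof.
apply: (@numerator_neq0 (s3 z) _ w) => //; first by rewrite fmorph_eq0.
by apply_images; field.
Qed.

Let yt_neq0 : y - t != 0.
Proof. by have := y0; rewrite -(fmorph_eq0 s0) E0. Qed.

Let w4_neq0 : (- w * z + 2 * a4) * z - 1 != 0.
Proof.
apply: (@numerator_neq0 (s4 w) _ (z ^+ 2)); rewrite ?fmorph_eq0 ?sqrf_eq0 //.
by apply_images; field.
Qed.

Let z34_neq0 : - z * ((- w * z + 2 * a4) * z - 1) + (a3 + 2 * a4) * (z * z) != 0.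
Proof.
apply: (@numerator_neq0 (s4 (s3 z)) _ _ _ w4_neq0); first by rewrite !fmorph_eq0.
by apply_images; field; rewrite z0 w4_neq0.
Qed.

Let w43_neq0 :
  (- w * (z * w + a3) + 2 * (a4 + a3) * w) * (z * w + a3) - w ^+ 2 != 0.
Proof.
apply: (@numerator_neq0 (s3 (s4 w)) _ ((z * w + a3) ^+ 2)).
- by rewrite !fmorph_eq0.
- by rewrite sqrf_eq0.
by apply_images; field; rewrite w0 z3_neq0.
Qed.

Let y12_neq0 : y * (x * y + a1 + - z * y) - (a2 + a1) * y != 0.
Proof.
by rewrite (_ : _ - _ = y * (y * (x - z) - a2)) ?mulf_neq0 //; ring.
Qed.

Let xz12_neq0 :
  x * (y * (x - z) - a2) + (a1 + a2) * (x - z) + - z * (y * (x - z) - a2) != 0.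
Proof.
by rewrite (_ : _ + _ = (x - z) * (x * y + a1 + - z * y)) ?mulf_neq0 //; ring.
Qed.

Let w23_neq0 : w * (x * w - (z * w + a3)) + (a2 + a3) * w != 0.
Proof.
by rewrite (_ : _ + _ = w * (w * (x - z) + a2)) ?mulf_neq0 //; ring.
Qed.

Let xz23_neq0 :
  x * (w * (x - z) + a2) - (z * (w * (x - z) + a2) + (a3 + a2) * (x - z)) != 0.
Proof.
by rewrite (_ : _ - _ = (x - z) * (x * w - (z * w + a3))) ?mulf_neq0 //; ring.
Qed.

Let w434_neq0 :
  (- ((- w * z + 2 * a4) * z - 1) *
   (- z * ((- w * z + 2 * a4) * z - 1) + (a3 + 2 * a4) * (z * z)) +
   2 * (- a4 + (a3 + 2 * a4)) * ((- w * z + 2 * a4) * z - 1) * (z * z)) *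
  (- z * ((- w * z + 2 * a4) * z - 1) + (a3 + 2 * a4) * (z * z)) +
  - (((- w * z + 2 * a4) * z - 1) * ((- w * z + 2 * a4) * z - 1)) * (z * z) != 0.
Proof.
apply: (@numerator_neq0 (s4 (s3 (s4 w))) _
  ((z * (- z * ((- w * z + 2 * a4) * z - 1) + (a3 + 2 * a4) * (z * z))) ^+ 2)).
- by rewrite !fmorph_eq0.
- by rewrite sqrf_eq0 mulf_neq0.
by apply_images; field; rewrite z0 w4_neq0 z34_neq0.
Qed.

Let z343_neq0 :
  - (z * w + a3) *
  ((- w * (z * w + a3) + 2 * (a4 + a3) * w) * (z * w + a3) - w ^+ 2) +
  (- a3 + 2 * (a4 + a3)) * ((z * w + a3) * (z * w + a3)) * w != 0.
Proof.
apply: (@numerator_neq0 (s3 (s4 (s3 z))) _ (w *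
  ((- w * (z * w + a3) + 2 * (a4 + a3) * w) * (z * w + a3) - w ^+ 2))).
- by rewrite !fmorph_eq0.
- by rewrite mulf_neq0.
by apply_images; field; rewrite w0 z3_neq0 w43_neq0.
Qed.

(** For involutions, the relation of order m amounts to the equality of two alternating products of
    length m. In this form the rational expressions to compare are only half as deep. *)
Lemma commute02 : agree (s0 \o s2) (s2 \o s0). Proof. agree_tac. Qed.
Lemma commute03 : agree (s0 \o s3) (s3 \o s0). Proof. agree_tac. Qed.
Lemma commute04 : agree (s0 \o s4) (s4 \o s0). Proof. agree_tac. Qed.
Lemma commute13 : agree (s1 \o s3) (s3 \o s1). Proof. agree_tac. Qed.
Lemma commute14 : agree (s1 \o s4) (s4 \o s1). Proof. agree_tac. Qed.
Lemma commute24 : agree (s2 \o s4) (s4 \o s2).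
Proof. agree_tac. Qed.
Lemma braid12 : agree (s1 \o s2 \o s1) (s2 \o s1 \o s2).
Proof. agree_tac. Qed.
Lemma braid23 : agree (s2 \o s3 \o s2) (s3 \o s2 \o s3).
Proof. agree_tac. Qed.
Lemma braid01 : agree (s0 \o s1 \o s0 \o s1) (s1 \o s0 \o s1 \o s0).
Proof. agree_tac. Qed.
Lemma pi0 : agree (p \o s0) (s4 \o p).
Proof. agree_tac. Qed.
Lemma pi1 : agree (p \o s1) (s3 \o p).
Proof. agree_tac. Qed.
Lemma pi2 : agree (p \o s2) (s2 \o p).
Proof. agree_tac. Qed.
Lemma braid34 : agree (s3 \o s4 \o s3 \o s4) (s4 \o s3 \o s4 \o s3).
Proof. agree_tac. Qed.
End Relations.

(** * Faithfulness of the geometric representation *)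

(** For distinct [i] and [j] this is minus the Cartan integer: the coefficient of [alpha_i] added to
    [alpha_j] by [s_i]. *)
Definition D52_cartan (i j : 'I_5) : nat :=
  if (i.+1 == j) || (j.+1 == i)
  then if (nat_of_ord i, nat_of_ord j) \in [:: (0, 1); (4, 3)]%N then 2%N else 1%N
  else 0%N.

(** Ties the Coxeter number to the two Cartan integers. For order 4 only their product is recorded,
    which treats both orientations of a double bond at once. *)
Variant coxeter_spec (i j : 'I_5) : nat -> nat -> nat -> Prop :=
| CoxeterSpec2 : coxeter_spec i j 2 0 0
| CoxeterSpec3 : coxeter_spec i j 3 1 1
| CoxeterSpec4 n n' of (n * n' = 2)%N : coxeter_spec i j 4 n n'.

Lemma coxeterP (i j : 'I_5) : i != j ->
  coxeter_spec i j (D52_coxeter i j) (D52_cartan i j) (D52_cartan j i).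
Proof.
case: i => [[|[|[|[|[|//]]]]] ?]; case: j => [[|[|[|[|[|//]]]]] ?];
  rewrite /D52_coxeter /D52_cartan -val_eqE //= => _;
  by [apply: CoxeterSpec2 | apply: CoxeterSpec3 | apply: CoxeterSpec4].
Qed.

(** * Words and reduced words in the abstract Coxeter group *)

Lemma D52_eq_catl u v v' : D52_eq v v' -> D52_eq (u ++ v) (u ++ v').
Proof. by move=> h; apply: D52_cat h; apply: D52_refl. Qed.

Lemma D52_eq_catr u v v' : D52_eq v v' -> D52_eq (v ++ u) (v' ++ u).
Proof. by move=> h; apply: (D52_cat h); apply: D52_refl. Qed.

Lemma D52_eq_double i : D52_eq [:: i; i] [::].
Proof. by have := D52_rel i i; rewrite /D52_coxeter eqxx. Qed.

Lemma D52_eq_revl u : D52_eq (rev u ++ u) [::].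
Proof.
elim: u => [|i u IH]; first exact: D52_refl.
rewrite rev_cons cat_rcons -[i :: i :: u]/([:: i; i] ++ u).
apply: D52_trans IH; apply: D52_eq_catl.
exact: (D52_eq_catr u (D52_eq_double i)).
Qed.

Lemma D52_eq_cancel u v : D52_eq (u ++ v) [::] -> D52_eq v (rev u).
Proof.
move=> h; apply: (@D52_trans _ (rev u ++ (u ++ v))).
  by rewrite catA; apply/D52_sym; apply: (D52_eq_catr v (D52_eq_revl u)).
by rewrite -[X in D52_eq _ X]cats0; apply: D52_eq_catl.
Qed.

(** Every relator has even length. Consequently appending a letter to a reduced word never preserves
    the minimal length. *)
Lemma D52_eq_odd u v : D52_eq u v -> odd (size u) = odd (size v).
Proof.
elim=> [i j|//|? ? _ -> //|? ? ? _ -> _ -> //|u1 u2 v1 v2 _ h1 _ h2].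
  by elim: (D52_coxeter i j) => //= n ->; rewrite negbK.
by rewrite !size_cat !oddD h1 h2.
Qed.

Definition D52_reduced (u : seq 'I_5) : Prop :=
  forall v, D52_eq u v -> (size u <= size v)%N.

Lemma D52_reduced_exists u : exists2 v, D52_eq u v & D52_reduced v.
Proof.
have [n le_un] := ubnP (size u).
elim: n u le_un => // n IH u le_un.
have [red|] := EM (D52_reduced u); first by exists u => //; apply: D52_refl.
move=> /existsNP[v /not_implyP[uv /negP]]; rewrite -ltnNge => lt_vu.
have [|v' vv' red] := IH v; first exact: leq_trans lt_vu le_un.
by exists v' => //; apply: D52_trans vv'.
Qed.

Lemma D52_reducedl u v : D52_reduced (u ++ v) -> D52_reduced u.
Proof.
move=> red u' /(D52_eq_catr v)/red.
by rewrite !size_cat leq_add2r.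
Qed.

Lemma D52_reduced_eq u v :
  D52_eq u v -> (size v <= size u)%N -> D52_reduced u -> D52_reduced v.
Proof.
by move=> uv le_vu red v' vv'; apply: leq_trans le_vu _; apply/red/(D52_trans uv).
Qed.

(* The alternating word ... i j i j with k letters, the last one being j. *)
Fixpoint alternating (i j : 'I_5) (k : nat) : seq 'I_5 :=
  if k is k'.+1 then (if odd k' then i else j) :: alternating i j k' else [::].

Lemma size_alternating i j k : size (alternating i j k) = k.
Proof. by elim: k => //= k ->. Qed.

(** With m the Coxeter number, an alternating word of m + 1 letters is a right factor of the relator
    of length 2m, hence equals the reverse of the remaining m - 1 letters. *)
Lemma alternating_coxeter i j : i != j -> exists2 v,
  D52_eq (rcons (alternating i j (D52_coxeter i j)) i) v
  & (size v < D52_coxeter i j)%N.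
Proof.
move=> neq_ij; have := D52_rel j i.
have -> : D52_coxeter j i = D52_coxeter i j.
  by rewrite /D52_coxeter eq_sym orbC minnC.
case: (coxeterP neq_ij) => [||n n' _] /= rel.
- exists (rev [:: j]) => //; apply: D52_eq_cancel.
  by apply: D52_trans rel; apply: D52_refl.
- by exists (rev [:: j; i]) => //; apply: D52_eq_cancel.
- by exists (rev [:: j; i; j]) => //; apply: D52_eq_cancel.
Qed.

(** * Positivity of roots and faithfulness *)

Section Faithful.
Variables (V : zmodType) (S : 'I_5 -> V -> V) (al : 'I_5 -> V).

Definition act (u : seq 'I_5) : V -> V :=
  foldr (fun i (g : V -> V) => S i \o g) idfun u.

Hypothesis actE : forall u v, D52_eq u v -> act u =1 act v.
Hypothesis S_add : forall i, {morph S i : x y / x + y}.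
Hypothesis S_simple : forall i, S i (al i) = - al i.
Hypothesis S_root : forall i j, i != j ->
  S i (al j) = al j + al i *+ D52_cartan i j.
Hypothesis al_free : forall c : 'I_5 -> nat,
  \sum_j al j *+ c j = 0 -> forall j, c j = 0%N.

Lemma act_cat u v x : act (u ++ v) x = act u (act v x).
Proof. by elim: u => //= i u ->. Qed.

Lemma actD u : {morph act u : x y / x + y}.
Proof. by elim: u => //= i u IH x y; rewrite -S_add -IH. Qed.

Lemma act0 u : act u 0 = 0.
Proof. by apply: (addrI (act u 0)); rewrite -actD !addr0. Qed.

Lemma actN u x : act u (- x) = - act u x.
Proof. by apply: (addrI (act u x)); rewrite -actD !subrr act0. Qed.

Lemma actMn u n x : act u (x *+ n) = act u x *+ n.
Proof. by elim: n => [|n IH]; rewrite ?mulr0n ?act0 // !mulrS actD IH. Qed.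

Definition positive (x : V) : Prop :=
  exists c : 'I_5 -> nat, x = \sum_j al j *+ c j.

Lemma positive_al i : positive (al i).
Proof.
exists (fun j => (j == i) : nat); rewrite (bigD1 i) //= eqxx big1 ?addr0 //.
by move=> j /negPf ->.
Qed.

Lemma positiveD x y : positive x -> positive y -> positive (x + y).
Proof.
move=> [c ->] [d ->]; exists (fun j => c j + d j)%N.
by rewrite -big_split; apply: eq_bigr => j _; rewrite mulrnDr.
Qed.

Lemma positiveMn x n : positive x -> positive (x *+ n).
Proof.
move=> [c ->]; exists (fun j => c j * n)%N.
by rewrite -sumrMnl; apply: eq_bigr => j _; rewrite mulrnA.
Qed.

(** The rank-two case of positivity, computed root by root; since the Coxeter numbers are at most 4,
    only [k] up to 3 occurs. *)
Lemma act_alternating i j k : i != j -> (0 < k < D52_coxeter i j)%N ->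
  exists p q, act (alternating i j k) (al i) = al i *+ p + al j *+ q.
Proof.
move=> neq_ij; have neq_ji : j != i by rewrite eq_sym.
have SMn l n x : S l (x *+ n) = S l x *+ n := actMn [:: l] n x.
have Sij p q : S i (al i *+ p + al j *+ q) =
    al j *+ q + al i *+ (D52_cartan i j * q) - al i *+ p.
  rewrite S_add !SMn S_simple (S_root neq_ij).
  by rewrite mulNrn mulrnDl addrC mulrnA.
have Sji p q : S j (al i *+ p + al j *+ q) =
    al i *+ p + al j *+ (D52_cartan j i * p) - al j *+ q.
  rewrite S_add !SMn S_simple (S_root neq_ji).
  by rewrite mulNrn mulrnDl mulrnA.
have k1 : act (alternating i j 1) (al i) = al i + al j *+ D52_cartan j i.
  exact: S_root.
have k2 : act (alternating i j 2) (al i) =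
    al j *+ D52_cartan j i + al i *+ (D52_cartan i j * D52_cartan j i) - al i.
  rewrite -[act _ _]/(S i (act (alternating i j 1) (al i))) k1.
  by rewrite -[al i in LHS]mulr1n Sij mulr1n.
have k3 : act (alternating i j 3) (al i) =
    S j (act (alternating i j 2) (al i)) by [].
case: k => [//|[|[|[|k]]]].
- by exists 1%N, (D52_cartan j i); rewrite k1.
(* The reflection in [al i] subtracts one [al i]; the predecessor is a true subtraction because the
   product is positive when the order exceeds 2. *)
- move=> lt2m; exists (D52_cartan i j * D52_cartan j i).-1, (D52_cartan j i).
  have N_gt0 : (0 < D52_cartan i j * D52_cartan j i)%N.
    by move: lt2m; case: (coxeterP neq_ij) => [||n n' ->].
  by rewrite k2 -[in LHS](prednK N_gt0) mulrSr addrA addrK addrC.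
(* The order is 4 and the product of Cartan integers is 2, so the third reflection cancels the
   multiple of [al j] and returns [al i] itself. *)
- move=> lt3m; exists 1%N, 0%N; rewrite k3 k2; move: lt3m Sji.
  case: (coxeterP neq_ij) => [||n n' ->] // _ Sji.
  by rewrite mulr2n addrA addrK addrC -{1}[al i]mulr1n Sji muln1 addrK mulr0n addr0.
- by case: (coxeterP neq_ij).
Qed.

(* Tits' argument: if the word u cannot be shortened by appending i, split off
   a maximal right factor of u in the dihedral subgroup generated by i and the
   last letter j of u. *)
Lemma positive_act u i : D52_reduced (rcons u i) -> positive (act u (al i)).
Proof.
have [n] := ubnP (size u); elim: n u i => // n IH u0 i.
case: (lastP u0) => [|u' j] lt_un red_ui; first exact: positive_al.
have neq_ij : i != j.
  apply/eqP=> eq_ij; move: red_ui; rewrite eq_ij => red.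
  have := red u'; rewrite !size_rcons.
  suff /[swap]/[apply] : D52_eq (rcons (rcons u' j) j) u' by lia.
  rewrite -!cats1 -catA -[X in D52_eq _ X]cats0.
  exact/D52_eq_catl/D52_eq_double.
set u := rcons u' j in lt_un red_ui *.
(* [k] is the length of the dihedral right factor found so far and [d] the room left below the
   Coxeter number. The induction on [d] starts from the single letter [j]. *)
suff H d k v : (d + k = D52_coxeter i j)%N -> (0 < k)%N -> (0 < d)%N ->
    (size v + k = size u)%N -> D52_eq u (v ++ alternating i j k) ->
    positive (act u (al i)).
  refine (H (D52_coxeter i j).-1 1%N u' _ _ _ _ _) => //.
  - by case: (coxeterP neq_ij).
  - by case: (coxeterP neq_ij).
  - by rewrite size_rcons addn1.
  - by rewrite /u -cats1; apply: D52_refl.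
clearbody u; elim: d k v => // d IHd k v dk k_gt0 _ size_vk u_vk.
have red_vki : D52_reduced (rcons (v ++ alternating i j k) i).
  apply: D52_reduced_eq red_ui; last first.
    by rewrite !size_rcons size_cat size_alternating size_vk.
  by rewrite -!cats1; apply: D52_eq_catr.
have red_vk : D52_reduced (v ++ alternating i j k).
  by move: red_vki; rewrite -cats1; apply: D52_reducedl.
case: k dk k_gt0 size_vk u_vk red_vki red_vk => // k dk _ size_vk u_vk red_vki red_vk.
(* [c] is the first letter of the alternating factor, so [v] followed by [c] is reduced as a prefix
   of a reduced word. Only the other letter [d'] remains to be examined. *)
pose c := if odd k then i else j; pose d' := if odd k then j else i.
have red_vc : D52_reduced (rcons v c).
  by move: red_vk; rewrite /= -cat_rcons; apply: D52_reducedl.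
have red_v : D52_reduced v by apply: D52_reducedl red_vk.
(* If both extensions of [v] are reduced, [v] keeps [al i] and [al j] positive by induction, and the
   dihedral factor contributes natural coefficients. *)
have [red_vd|] := EM (D52_reduced (rcons v d')).
  have lt_vn : (size v < n)%N by lia.
  have [vi vj] : positive (act v (al i)) /\ positive (act v (al j)).
    move: red_vc red_vd; rewrite /c /d'.
    by case: (odd k) => ? ?; split; apply: IH.
  rewrite (actE u_vk) act_cat.
  have [|p [q ->]] := @act_alternating i j k.+1 neq_ij; first by lia.
  by rewrite actD !actMn; apply: positiveD; apply: positiveMn.
move=> /existsNP[v2 /not_implyP[vd_v2 /negP]]; rewrite size_rcons -ltnNge => lt_v2.
have v_v2d : D52_eq v (rcons v2 d').
  apply: (@D52_trans _ (rcons v d' ++ [:: d'])).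
    rewrite cat_rcons -{1}[v]cats0.
    by apply/D52_eq_catl/D52_sym/D52_eq_double.
  by rewrite -(cats1 v2); apply: D52_eq_catr.
(* Minimality of [v] bounds the lengths on one side, [lt_v2] on the other, and parity excludes
   equality. So [d'] can be moved from [v] to the dihedral factor. *)
have size_v : (size v = (size v2).+1)%N.
  have := red_v _ v_v2d; rewrite size_rcons => le_v.
  have := D52_eq_odd vd_v2; rewrite size_rcons /= => par.
  have : size v != size v2 by apply/eqP=> e; move: par; rewrite e; case: odd.
  by lia.
have u_v2 : D52_eq u (v2 ++ alternating i j k.+2).
  apply: D52_trans u_vk _.
  have -> : alternating i j k.+2 = d' :: alternating i j k.+1.
    by rewrite /d' /=; case: odd.
  by rewrite -cat_rcons; apply: D52_eq_catr.
have [d_eq0|d_gt0] := posnP d; last first.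
  by apply: (IHd k.+2 v2) => //; lia.
(* No room is left: appending [i] creates an alternating word longer than the Coxeter number, which
   shortens and contradicts [red_ui]. *)
have [s s_eq lt_s] := alternating_coxeter neq_ij.
have := red_ui (v2 ++ s); rewrite size_rcons size_cat => red.
have : D52_eq (rcons u i) (v2 ++ s).
  apply: (@D52_trans _ (v2 ++ rcons (alternating i j k.+2) i)).
    by rewrite -!cats1 catA; apply: D52_eq_catr.
  have -> : k.+2 = D52_coxeter i j by lia.
  exact: D52_eq_catl.
by move/red; lia.
Qed.

Lemma act_faithful u v : act u =1 act v -> D52_eq u v.
Proof.
move=> uv; have rvK x : act (rev v) (act v x) = x.
  by rewrite -act_cat (actE (D52_eq_revl v)).
have [w w_eq red_w] := D52_reduced_exists (rev v ++ u).
have w1 x : act w x = x by rewrite -(actE w_eq) act_cat uv rvK.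
suff w0 : w = [::].
  by rewrite w0 in w_eq; have := D52_eq_cancel w_eq; rewrite revK.
case: (lastP w) red_w w1 => // w' i red_w w1; exfalso.
have [c Ec] := positive_act red_w.
(* [w] fixes [al i] but also sends it to minus a positive combination; the resulting null sum has a
   positive coefficient at [i]. *)
have := w1 (al i); rewrite -cats1 act_cat /= S_simple actN => /eqP.
rewrite eq_sym -subr_eq0 opprK Ec => /eqP {Ec}.
have -> : al i + \sum_j al j *+ c j = \sum_j al j *+ ((j == i) + c j).
  rewrite (bigD1 i) //= [RHS](bigD1 i) //= eqxx mulrS addrA; congr (_ + _).
  by apply: eq_bigr => j /negPf ->.
by move/al_free/(_ i); rewrite eqxx.
Qed.
End Faithful.

(** The rows of the table are the parameter tuples of the five generators. *)
Lemma D52_rootE (K : fieldType) (a0 a1 a2 a3 a4 : K) (i j : 'I_5) : i != j ->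
  let a := [:: a0; a1; a2; a3; a4] in
  a`_j + a`_i *+ D52_cartan i j =
  (nth [::] [:: [:: - a0; a1 + 2 * a0; a2; a3; a4]; [:: a0 + a1; - a1; a2 + a1; a3; a4];
      [:: a0; a1 + a2; - a2; a3 + a2; a4]; [:: a0; a1; a2 + a3; - a3; a4 + a3];
      [:: a0; a1; a2; a3 + 2 * a4; - a4]] i)`_j.
Proof.
case: i => [[|[|[|[|[|//]]]]] i]; case: j => [[|[|[|[|[|//]]]]] j] //= _;
  by rewrite /D52_cartan /= ?mulr0n ?addr0 // mulr_natl.
Qed.

(** * The group generated by the automorphisms *)

Section Symmetry.
Variable R : realType.
Local Notation K := (ratfun R).
Implicit Types f g : {rmorphism K -> K}.

Local Notation images f := (images (K := K) (Kx R) (Ky R) (Kz R) (Kw R) (Kt R)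
  (Ka R)`_0 (Ka R)`_1 (Ka R)`_2 (Ka R)`_3 (Ka R)`_4 f).
Local Notation agree f g := (agree (K := K) (Kx R) (Ky R) (Kz R) (Kw R) (Kt R)
  (Ka R)`_1 (Ka R)`_2 (Ka R)`_3 (Ka R)`_4 f g).

Lemma automorphism_images f (X Y Z W T A0 A1 A2 A3 A4 : K) :
  automorphism_of (Transformation X Y Z W T [tuple A0; A1; A2; A3; A4]) f ->
  images f X Y Z W T A0 A1 A2 A3 A4.
Proof.
case=> _ _ [fx fy fz fw ft] fa; do !split=> //.
- exact: fa (Ordinal (isT : 0 < 5)%N).
- exact: fa (Ordinal (isT : 1 < 5)%N).
- exact: fa (Ordinal (isT : 2 < 5)%N).
- exact: fa (Ordinal (isT : 3 < 5)%N).
- exact: fa (Ordinal (isT : 4 < 5)%N).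
Qed.

Lemma agree_eq f g : (forall c, f (Kconst c) = Kconst c) ->
  (forall c, g (Kconst c) = Kconst c) -> agree f g -> f =1 g.
Proof.
move=> fC gC [[? ? ? ? ?] [? ? ? ?]].
apply: (@fraction_rmorph_eq 9 (Cplx R) K f g) => [c|].
  exact: etrans (fC c) (esym (gC c)).
by case=> [[|[|[|[|[|[|[|[|[|//]]]]]]]]] i]; rewrite (bool_irrelevance i isT).
Qed.

Variables (S : 'I_5 -> {rmorphism K -> K}) (P : {rmorphism K -> K}).
Hypothesis S_aut : forall i, automorphism_of (tr_s R i) (S i).
Hypothesis SK : forall i x, S i (S i x) = x.
Hypothesis P_aut : automorphism_of (tr_pi R) P.
Hypothesis PK : forall x, P (P x) = x.

Let i0 : 'I_5 := Ordinal (isT : 0 < 5)%N.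
Let i1 : 'I_5 := Ordinal (isT : 1 < 5)%N.
Let i2 : 'I_5 := Ordinal (isT : 2 < 5)%N.
Let i3 : 'I_5 := Ordinal (isT : 3 < 5)%N.
Let i4 : 'I_5 := Ordinal (isT : 4 < 5)%N.

Let S_const i c : S i (Kconst c) = Kconst c.
Proof. by case: (S_aut i). Qed.
Let P_const c : P (Kconst c) = Kconst c.
Proof. by case: P_aut. Qed.
Let E0 := automorphism_images (S_aut i0 : automorphism_of (tr_s0 R) _).
Let E1 := automorphism_images (S_aut i1 : automorphism_of (tr_s1 R) _).
Let E2 := automorphism_images (S_aut i2 : automorphism_of (tr_s2 R) _).
Let E3 := automorphism_images (S_aut i3 : automorphism_of (tr_s3 R) _).
Let E4 := automorphism_images (S_aut i4 : automorphism_of (tr_s4 R) _).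
Let Ep := automorphism_images P_aut.

Ltac by_agree lemma :=
  apply: agree_eq; first [by move=> c /=; rewrite ?S_const ?P_const ?S_const
    | eapply lemma;
      first [exact: E0|exact: E1|exact: E2|exact: E3|exact: E4|exact: Ep
            |exact: Kx_neq0|exact: Ky_neq0|exact: Kz_neq0|exact: Kw_neq0
            |exact: Kt_neq0|exact: KxBz_neq0]].

Let S02 : S i0 \o S i2 =1 S i2 \o S i0. Proof. by_agree commute02. Qed.
Let S03 : S i0 \o S i3 =1 S i3 \o S i0. Proof. by_agree commute03. Qed.
Let S04 : S i0 \o S i4 =1 S i4 \o S i0. Proof. by_agree commute04. Qed.
Let S13 : S i1 \o S i3 =1 S i3 \o S i1. Proof. by_agree commute13. Qed.
Let S14 : S i1 \o S i4 =1 S i4 \o S i1. Proof. by_agree commute14. Qed.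
Let S24 : S i2 \o S i4 =1 S i4 \o S i2. Proof. by_agree commute24. Qed.
Let S12 : S i1 \o S i2 \o S i1 =1 S i2 \o S i1 \o S i2.
Proof. by_agree braid12. Qed.
Let S23 : S i2 \o S i3 \o S i2 =1 S i3 \o S i2 \o S i3.
Proof. by_agree braid23. Qed.
Let S01 : S i0 \o S i1 \o S i0 \o S i1 =1 S i1 \o S i0 \o S i1 \o S i0.
Proof. by_agree braid01. Qed.
Let S34 : S i3 \o S i4 \o S i3 \o S i4 =1 S i4 \o S i3 \o S i4 \o S i3.
Proof. by_agree braid34. Qed.
Let P0 : P \o S i0 =1 S i4 \o P. Proof. by_agree pi0. Qed.
Let P1 : P \o S i1 =1 S i3 \o P. Proof. by_agree pi1. Qed.
Let P2 : P \o S i2 =1 S i2 \o P. Proof. by_agree pi2. Qed.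

Lemma diagram_automorphism i : P \o S i =1 S (rev_ord i) \o P.
Proof.
(* As [P] is an involution, the relations for the indices 0 and 1 yield those for 4 and 3. *)
have swap (j k : 'I_5) : P \o S j =1 S k \o P -> P \o S k =1 S j \o P.
  by move=> jk x; rewrite -[in LHS](PK x) /= -[S k _](jk (P x)) /= PK.
case: i => [[|[|[|[|[|//]]]]] i]; rewrite (bool_irrelevance i isT);
  set j := rev_ord _.
- by rewrite (_ : j = i4); [exact: P0|exact: val_inj].
- by rewrite (_ : j = i3); [exact: P1|exact: val_inj].
- by rewrite (_ : j = i2); [exact: P2|exact: val_inj].
- by rewrite (_ : j = i1); [exact: swap P1|exact: val_inj].
- by rewrite (_ : j = i0); [exact: swap P0|exact: val_inj].
Qed.

Lemma word_act_cat u v x : word_act S (u ++ v) x = word_act S u (word_act S v x).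
Proof. by elim: u => //= i u ->. Qed.

(** Since [i < j], the default branch is the case of order 4. *)
Lemma braid_lt (i j : 'I_5) : (i < j)%N ->
  match D52_coxeter i j with
  | 2 => S i \o S j =1 S j \o S i
  | 3 => S i \o S j \o S i =1 S j \o S i \o S j
  | _ => S i \o S j \o S i \o S j =1 S j \o S i \o S j \o S i
  end.
Proof.
case: i => [[|[|[|[|[|//]]]]] i]; case: j => [[|[|[|[|[|//]]]]] j] // _;
  rewrite (bool_irrelevance i isT) (bool_irrelevance j isT) /D52_coxeter.
- exact: S01.
- exact: S02.
- exact: S03.
- exact: S04.
- exact: S12.
- exact: S13.
- exact: S14.
- exact: S23.
- exact: S24.
- exact: S34.
Qed.

(** The braid relation turns half of the relator into the reverse of the other half, and the
    involutions then cancel from the middle outwards. *)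
Lemma word_act_coxeter (i j : 'I_5) x :
  word_act S (flatten (nseq (D52_coxeter i j) [:: i; j])) x = x.
Proof.
have [lt_ij|lt_ji|/val_inj <-] := ltngtP i j; last first.
- by rewrite /D52_coxeter eqxx /= SK.
- have := braid_lt lt_ji.
  have -> : D52_coxeter i j = D52_coxeter j i.
    by rewrite /D52_coxeter eq_sym orbC minnC.
  have neq_ji : j != i by rewrite -val_eqE ltn_eqF.
  case: (coxeterP neq_ji) => [||n n' _] /= B.
  + by rewrite -[S i (S j _)]B /= !SK.
  + by rewrite -[S i (S j (S i _))]B /= !SK.
  + by rewrite -[S i (S j (S i (S j _)))]B /= !SK.
- have := braid_lt lt_ij.
  have neq_ij : i != j by rewrite -val_eqE ltn_eqF.
  case: (coxeterP neq_ij) => [||n n' _] /= B.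
  + by rewrite [S i (S j _)]B /= !SK.
  + by rewrite [S i (S j (S i _))]B /= !SK.
  + by rewrite [S i (S j (S i (S j _)))]B /= !SK.
Qed.

Lemma word_act_eq u v : D52_eq u v -> word_act S u =1 word_act S v.
Proof.
elim=> [i j|//|? ? _ h|? ? ? _ h1 _ h2|u1 u2 v1 v2 _ h1 _ h2] x.
- exact: word_act_coxeter.
- by rewrite h.
- by rewrite h1.
- by rewrite !word_act_cat h2 h1.
Qed.

Lemma S_simple i : S i (Ka R)`_i = - (Ka R)`_i.
Proof.
have [_ _ _ /(_ i) ->] := S_aut i.
by case: i => [[|[|[|[|[|//]]]]] i]; rewrite (bool_irrelevance i isT).
Qed.

Lemma S_root i j : i != j ->
  S i (Ka R)`_j = (Ka R)`_j + (Ka R)`_i *+ D52_cartan i j.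
Proof.
move=> neq_ij; have [_ _ _ /(_ j) ->] := S_aut i.
have KaE (k : 'I_5) : (Ka R)`_k =
    [:: (Ka R)`_0; (Ka R)`_1; (Ka R)`_2; (Ka R)`_3; (Ka R)`_4]`_k.
  by case: k => [[|[|[|[|[|//]]]]] k].
rewrite (KaE i) (KaE j) D52_rootE //.
by case: (i) => [[|[|[|[|[|//]]]]] p]; case: (j) => [[|[|[|[|[|//]]]]] q];
  rewrite (bool_irrelevance p isT).
Qed.

Lemma word_act_faithful u v : word_act S u =1 word_act S v <-> D52_eq u v.
Proof.
split; last exact: word_act_eq.
apply: (@act_faithful K (fun i => S i) (fun i => (Ka R)`_i)).
- exact: word_act_eq.
- by move=> i x y; rewrite rmorphD.
- exact: S_simple.
- exact: S_root.
- exact: Ka_free.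
Qed.
End Symmetry.

Lemma weyl_group_realization (R : realType) :
  exists (S : 'I_5 -> {rmorphism ratfun R -> ratfun R})
         (P : {rmorphism ratfun R -> ratfun R}),
  [/\ forall i : 'I_5, automorphism_of (tr_s R i) (S i),
      automorphism_of (tr_pi R) P,
      forall u v : seq 'I_5, word_act S u =1 word_act S v <-> D52_eq u v,
      P \o P =1 idfun
    & forall i : 'I_5, P \o S i =1 S (rev_ord i) \o P].
Proof.
have [S S_aut] := fin_all_exists (@involution_s R).
have [P [P_aut PK]] := involution_pi R.
have SA i := (S_aut i).1; have SK i := (S_aut i).2.
exists S, P; split=> //; first exact: word_act_faithful SA SK.
exact: diagram_automorphism SA P_aut PK.
Qed.

(** * Backlund transformations *)

Import numFieldNormedType.Exports.

(** * Differentiation rules *)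

Section Derive.
Variables (F : numFieldType) (t : F).
Implicit Types f g : F -> F.

Lemma is_derive_comp1 f g a b : is_derive (g t) 1 f a -> is_derive t 1 g b ->
  is_derive t 1 (f \o g) (a * b).
Proof.
move=> [df <-] [dg <-].
have Df : differentiable f (g t) by apply/derivable1_diffP.
have Dg : differentiable g t by apply/derivable1_diffP.
split; first exact/derivable1_diffP/differentiable_comp.
rewrite !deriveE //; last exact: differentiable_comp.
by rewrite diff_comp //= -[X in 'd _ _ X = _]mulr1 [LHS]linearZ mulrC.
Qed.

Lemma derive_add f g a b : is_derive t 1 f a -> is_derive t 1 g b ->
  is_derive t 1 (fun u => f u + g u) (a + b).
Proof. exact: is_deriveD. Qed.

Lemma derive_opp f a : is_derive t 1 f a -> is_derive t 1 (fun u => - f u) (- a).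
Proof. exact: is_deriveN. Qed.

Lemma derive_mul f g a b : is_derive t 1 f a -> is_derive t 1 g b ->
  is_derive t 1 (fun u => f u * g u) (f t * b + g t * a).
Proof. exact: is_deriveM. Qed.

Lemma derive_sqr f a : is_derive t 1 f a ->
  is_derive t 1 (fun u => f u ^+ 2) (f t * a + f t * a).
Proof. by move=> fa; apply: derive_mul. Qed.

Lemma derive_inv f a : is_derive t 1 f a -> f t != 0 ->
  is_derive t 1 (fun u => (f u)^-1) (- (f t) ^- 2 * a).
Proof.
by move=> [df <-] ft0; split; [exact: derivableV|rewrite deriveV].
Qed.

Lemma derive_const a : is_derive t 1 ((fun=> a) : F -> F) 0.
Proof. exact: is_derive_cst. Qed.

Lemma derive_var : is_derive t 1 ((fun u => u) : F -> F) 1.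
Proof. exact: is_derive_id. Qed.
End Derive.

Ltac derive_step :=
  first
  [ eassumption
  | lazymatch goal with
    | |- is_derive _ _ (fun u => @?f u + @?g u) _ => eapply (@derive_add _ _ f g)
    | |- is_derive _ _ (fun u => - @?f u) _ => eapply (@derive_opp _ _ f)
    | |- is_derive _ _ (fun u => @?f u * @?g u) _ => eapply (@derive_mul _ _ f g)
    | |- is_derive _ _ (fun u => @?f u ^+ 2) _ => eapply (@derive_sqr _ _ f)
    | |- is_derive _ _ (fun u => (@?f u)^-1) _ => eapply (@derive_inv _ _ f)
    | |- is_derive _ _ (fun u => u) _ => eapply derive_var
    | |- is_derive _ _ (fun u => ?c) _ => eapply derive_const
    end].
Ltac derive_auto := eapply is_derive_eq; [repeat derive_step|]; cbv beta.

(** * The system as a flow, and the identity behind each generator *)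

Section System.
Variables (F : numFieldType).

Definition rhs_x (a2 a3 a4 x y z w t : F) : F :=
  2 * x ^+ 2 * y / t - x ^+ 2 - 2 * (a2 + a3 + a4) * x / t + 1 / t
  + 2 * z * (z * w + a3) / t.
Definition rhs_y (a1 a2 a3 a4 x y t : F) : F :=
  - (2 * x * y ^+ 2 / t) + 2 * x * y + 2 * (a2 + a3 + a4) * y / t + a1.
Definition rhs_z (a4 y z w t : F) : F :=
  2 * z ^+ 2 * w / t - z ^+ 2 - 2 * a4 * z / t + 1 / t + 2 * y * z ^+ 2 / t.
Definition rhs_w (a3 a4 y z w t : F) : F :=
  - (2 * z * w ^+ 2 / t) + 2 * z * w + 2 * a4 * w / t + a3
  - 2 * y * (2 * z * w + a3) / t.

(* At time t, the curve (x, y, z, w) has e times the velocity prescribed by the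
   system at the value u of the independent variable. *)
Definition flow (a1 a2 a3 a4 : F) (x y z w : F -> F) (t e : F) (u : F) : Prop :=
  [/\ is_derive t 1 x (e * rhs_x a2 a3 a4 (x t) (y t) (z t) (w t) u),
      is_derive t 1 y (e * rhs_y a1 a2 a3 a4 (x t) (y t) u),
      is_derive t 1 z (e * rhs_z a4 (y t) (z t) (w t) u)
    & is_derive t 1 w (e * rhs_w a3 a4 (y t) (z t) (w t) u)].

Variables (a0 a1 a2 a3 a4 : F) (x y z w : F -> F) (t : F).
Hypothesis a_adm : a0 + a1 + a2 + a3 + a4 = 2^-1.
Hypothesis t0 : t != 0.
Hypothesis xyzw : flow a1 a2 a3 a4 x y z w t 1 t.

Let a0E : a0 = 2^-1 - (a1 + a2 + a3 + a4).
Proof. by rewrite -a_adm; ring. Qed.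

Ltac flow_tac :=
  case: xyzw => dx dy dz dw; split; derive_auto; rewrite ?mul1r //;
  rewrite /rhs_x /rhs_y /rhs_z /rhs_w ?a0E;
  try field; rewrite ?oppr_eq0 ?mulf_neq0 ?expf_neq0 ?t0 //.

(** The new time is [- t], hence the factor -1 and the right-hand sides taken at [- t]; the same
    holds for [flow_s4]. *)
Lemma flow_s0 : flow (a1 + 2 * a0) a2 a3 a4
  x (fun u => y u - u) z w t (-1) (- t).
Proof. flow_tac. Qed.

Lemma flow_s1 : y t != 0 -> flow (- a1) (a2 + a1) a3 a4
  (fun u => x u + a1 / y u) y z w t 1 t.
Proof. by move=> y0; flow_tac; rewrite y0. Qed.

Lemma flow_s2 : x t - z t != 0 -> flow (a1 + a2) (- a2) (a3 + a2) a4
  x (fun u => y u - a2 / (x u - z u)) z (fun u => w u + a2 / (x u - z u)) t 1 t.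
Proof. by move=> xz0; flow_tac; rewrite xz0. Qed.

Lemma flow_s3 : w t != 0 -> flow a1 (a2 + a3) (- a3) (a4 + a3)
  x y (fun u => z u + a3 / w u) w t 1 t.
Proof. by move=> w0; flow_tac; rewrite w0. Qed.

Lemma flow_s4 : z t != 0 -> flow a1 a2 (a3 + 2 * a4) (- a4)
  (fun u => - x u) (fun u => - y u) (fun u => - z u)
  (fun u => - w u + 2 * a4 / z u - 1 / z u ^+ 2) t (-1) (- t).
Proof. by move=> z0; flow_tac; rewrite z0. Qed.

Lemma flow_pi : x t != 0 -> z t != 0 -> flow a3 a2 a1 a0
  (fun u => 1 / (u * z u)) (fun u => - (u * (z u * w u + a3) * z u))
  (fun u => 1 / (u * x u)) (fun u => - (u * (x u * y u + a1) * x u)) t 1 t.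
Proof. by move=> x0 z0; flow_tac; rewrite ?x0 ?z0. Qed.
End System.

(** * A common criterion for Backlund transformations *)

Section Backlund.
Variable R : realType.
Local Notation C := (Cplx R).
Implicit Types (a : 5.-tuple C) (x y z w t : C).

Local Notation value x y z w t a :=
  (@fvalue 9 C C idfun (coordinates x y z w t a`_1 a`_2 a`_3 a`_4)).

Lemma solutionE a (U : set C) (x y z w : C -> C) :
  solution a U x y z w <-> open U /\ forall t, U t ->
    t != 0 /\ flow a`_1 a`_2 a`_3 a`_4 x y z w t 1 t.
Proof.
have flowE t : flow a`_1 a`_2 a`_3 a`_4 x y z w t 1 t <->
    [/\ is_derive t 1 x (rhs_x a`_2 a`_3 a`_4 (x t) (y t) (z t) (w t) t),
        is_derive t 1 y (rhs_y a`_1 a`_2 a`_3 a`_4 (x t) (y t) t),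
        is_derive t 1 z (rhs_z a`_4 (y t) (z t) (w t) t)
      & is_derive t 1 w (rhs_w a`_3 a`_4 (y t) (z t) (w t) t)].
  by rewrite /flow !mul1r.
split=> [[oU sol]|[oU sol]]; split=> // t Ut.
  by have [t0 dx dy dz dw] := sol t Ut; split=> //; apply/flowE; split.
have [t0 /flowE[dx dy dz dw]] := sol t Ut; split; first exact: t0.
- exact: dx.
- exact: dy.
- exact: dz.
- exact: dw.
Qed.

(* e is the constant dt'/dt; D is the condition for the transformation to be
   defined. *)
Lemma Backlund_criterion (e : C) (X Y Z W T A0 A1 A2 A3 A4 : ratfun R)
    (b : 5.-tuple C -> 5.-tuple C) (D : C -> C -> C -> C -> Prop)
    (FX FY FZ FW : 5.-tuple C -> C -> C -> C -> C -> C -> C) :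
  e * e = 1 ->
  (forall a, admissible a -> admissible (b a)) ->
  (forall a x y z w t, admissible a ->
    let value := value x y z w t a in
    [/\ value T (e * t), value A0 (b a)`_0, value A1 (b a)`_1,
        value A2 (b a)`_2 & value A3 (b a)`_3 /\ value A4 (b a)`_4]) ->
  (forall a x y z w t vx vy vz vw, admissible a -> t != 0 ->
    let value := value x y z w t a in
    value X vx -> value Y vy -> value Z vz -> value W vw -> D x y z w) ->
  (forall a x y z w t, t != 0 -> D x y z w ->
    let value := value x y z w t a in
    [/\ value X (FX a x y z w t), value Y (FY a x y z w t),
        value Z (FZ a x y z w t) & value W (FW a x y z w t)]) ->
  (forall a (x y z w : C -> C) t, admissible a -> t != 0 ->
    D (x t) (y t) (z t) (w t) ->
    flow a`_1 a`_2 a`_3 a`_4 x y z w t 1 t ->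
    let F (G : 5.-tuple C -> C -> C -> C -> C -> C -> C) u :=
      G a (x u) (y u) (z u) (w u) u in
    flow (b a)`_1 (b a)`_2 (b a)`_3 (b a)`_4 (F FX) (F FY) (F FZ) (F FW)
      t e (e * t)) ->
  Backlund (Transformation X Y Z W T [tuple A0; A1; A2; A3; A4]).
Proof.
move=> ee b_adm Tb_value D_value F_value F_flow a adm; exists (b a); first exact: b_adm.
move=> U x y z w /solutionE[oU sol] V T' X' Y' Z' W' oV VU injT val.
have eK u : e * (e * u) = u by rewrite mulrA ee mul1r.
(* Values are unique, so the new time is the multiplication by [e], which is its own inverse. *)
have T'E t : V t -> T' t = e * t.
  move=> Vt; have [[vT _ _ _ _] _] := val t Vt.
  have [vT' _ _ _ _] := Tb_value a (x t) (y t) (z t) (w t) t adm.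
  exact: fvalue_inj vT vT'.
have DV t : V t -> D (x t) (y t) (z t) (w t).
  move=> Vt; have [[_ vx vy vz vw] _] := val t Vt.
  exact: D_value adm (sol t (VU t Vt)).1 vx vy vz vw.
pose F (G : 5.-tuple C -> C -> C -> C -> C -> C -> C) u :=
  G a (x u) (y u) (z u) (w u) u.
have FV t : V t -> [/\ X' (T' t) = F FX t, Y' (T' t) = F FY t,
    Z' (T' t) = F FZ t & W' (T' t) = F FW t].
  move=> Vt; have [[_ vx vy vz vw] _] := val t Vt.
  have [vx' vy' vz' vw'] := F_value a _ _ _ _ t (sol t (VU t Vt)).1 (DV t Vt).
  split; [exact: fvalue_inj vx vx'|exact: fvalue_inj vy vy'
    |exact: fvalue_inj vz vz'|exact: fvalue_inj vw vw'].
split.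
  move=> t Vt; have [_ v0 v1 v2 [v3 v4]] := Tb_value a (x t) (y t) (z t) (w t) t adm.
  by case=> [[|[|[|[|[|//]]]]] i].
(* The image is thus a preimage under a continuous map, which gives its openness. *)
have imV u : (T' @` V)%classic u <-> V (e * u).
  split=> [[t Vt <-]|Veu]; first by rewrite T'E // eK.
  by exists (e * u); rewrite ?T'E ?eK.
apply/solutionE; split.
  have -> : (T' @` V)%classic = (( *%R e) @^-1` V)%classic.
    by apply/seteqP; split=> u /imV.
  by apply: open_comp => // u _; apply: mulrl_continuous.
move=> u /imV Veu.
have near_V : \forall v \near u, V (e * v).
  exact: (@mulrl_continuous C e u V (open_nbhs_nbhs (conj oV Veu))).
have [eu0 fl] := sol (e * u) (VU _ Veu).
split; first by apply: contra_neq eu0 => ->; rewrite mulr0.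
have [X'u Y'u Z'u W'u] := FV (e * u) Veu; rewrite !T'E ?eK // in X'u Y'u Z'u W'u.
(* [H] is known only on the image of [V], so the chain rule is applied to a function equal to it
   near [u]. The two factors [e], from the flow and from the change of time, multiply to 1. *)
have comp G H r : (forall t, V t -> H (T' t) = F G t) ->
    is_derive (e * u) 1 (F G) (e * r) -> is_derive u 1 H (1 * r).
  move=> HG dG; rewrite (_ : 1 * r = e * r * e); last first.
    by rewrite -ee mulrAC.
  apply: (@near_eq_is_derive _ _ _ (F G \o *%R e)).
    near=> v; have Vev : V (e * v) by near: v.
    by rewrite /= -HG // T'E // eK.
  apply: (@is_derive_comp1 _ u (F G) ( *%R e) _ _ dG).
  by apply: is_derive_eq (derive_mul (derive_const u e) (derive_var u)) _;
    rewrite mulr1 mulr0 addr0.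
have := F_flow a x y z w (e * u) adm eu0 (DV _ Veu) fl.
rewrite eK -/F /flow => -[dX dY dZ dW].
rewrite X'u Y'u Z'u W'u; split.
- by apply: comp dX => t /FV[].
- by apply: comp dY => t /FV[].
- by apply: comp dZ => t /FV[].
- by apply: comp dW => t /FV[].
Unshelve. all: by end_near.
Qed.
End Backlund.

Lemma pvalue_eq n (C L : fieldType) (phi : {rmorphism C -> L}) P
  (f : {fraction (mpoly n C)}) q r :
  @pvalue n C L phi P f q -> q = r -> pvalue phi P f r.
Proof. by move=> fq <-. Qed.

(** * Nonvanishing of denominators where a transformation is defined *)

Section Poles.
Variables (R : realType) (x y z w t a1 a2 a3 a4 : Cplx R).
Local Notation value :=
  (@fvalue 9 (Cplx R) (Cplx R) idfun (coordinates x y z w t a1 a2 a3 a4)).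
Local Notation deformation b1 b2 b3 b4 :=
  (coordinates x%:P y%:P z%:P w%:P t%:P b1 b2 b3 b4).
Implicit Type f : ratfun R.

Lemma deformation_eval b1 b2 b3 b4 :
  b1.[0] = a1 -> b2.[0] = a2 -> b3.[0] = a3 -> b4.[0] = a4 ->
  forall k, (deformation b1 b2 b3 b4 k).[0] = coordinates x y z w t a1 a2 a3 a4 k.
Proof.
move=> e1 e2 e3 e4; case=> [[|[|[|[|[|[|[|[|[|//]]]]]]]]] ?];
  by rewrite /coordinates /= ?hornerC.
Qed.

Lemma ratfun_pole b1 b2 b3 b4 f g h v q :
  b1.[0] = a1 -> b2.[0] = a2 -> b3.[0] = a3 -> b4.[0] = a4 ->
  pvalue idfun (deformation b1 b2 b3 b4) g 0 ->
  pvalue idfun (deformation b1 b2 b3 b4) h q -> q != 0 -> f * g = h ->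
  ~ value f v.
Proof.
by move=> e1 e2 e3 e4; apply: fvalue_pole; apply: deformation_eval.
Qed.

Lemma polyX_addC_neq0 (c : Cplx R) : 'X + c%:P != 0.
Proof. by rewrite -size_poly_eq0 size_XaddC. Qed.

Ltac pvalue_step :=
  lazymatch goal with
  | |- pvalue _ _ (_ + _) _ => eapply pvalueD
  | |- pvalue _ _ (- _) _ => eapply pvalueN
  | |- pvalue _ _ (_ * _) _ => eapply pvalueM
  | |- pvalue _ _ 1 _ => eapply pvalue1
  | |- pvalue _ _ (_%:R) _ => eapply pvalue_nat
  | |- pvalue _ _ _ _ =>
      eapply pvalue_eq; [eapply pvalueX|lazy [coordinates nth nat_of_ord]; reflexivity]
  end.
Ltac generic_field R :=
  generalize_generators R => K ? ? ? ? ? ? ? ? ? ? ? ? ? ? ?; field; rewrite_neq0.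
Ltac pole_tac fv g h b1 b2 b3 b4 :=
  apply: (@ratfun_pole b1 b2 b3 b4 _ g h _ _ _ _ _ _ _ _ _ _ fv);
  [ rewrite ?hornerE // .. | eapply pvalue_eq; [repeat pvalue_step|]
  | repeat pvalue_step | | ].

(** At [y = 0] the numerator reduces to [alpha_1], which may itself vanish at the point; moving
    [alpha_1] alone makes it a nonzero polynomial. The parameters [alpha_2] and [alpha_3] play this
    part for [s_2] and [s_3]. *)
Lemma s1_pole v : value (Kx R + (Ka R)`_1 / Ky R) v -> y != 0.
Proof.
move=> fv; apply/eqP => y0.
pole_tac fv (Ky R) (Kx R * Ky R + (Ka R)`_1) ('X + a1%:P) (a2%:P) (a3%:P) (a4%:P).
- by rewrite y0.
- by rewrite y0 polyC0 mulr0 add0r polyX_addC_neq0.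
- by generic_field R.
Qed.

Lemma s2_pole v : value (Ky R - (Ka R)`_2 / (Kx R - Kz R)) v -> x - z != 0.
Proof.
move=> fv; apply/eqP => xz0.
pole_tac fv (Kx R - Kz R) (Ky R * (Kx R - Kz R) - (Ka R)`_2)
  (a1%:P) ('X + a2%:P) (a3%:P) (a4%:P).
- by rewrite -polyCB xz0.
- by rewrite -polyCB xz0 polyC0 mulr0 add0r oppr_eq0 polyX_addC_neq0.
- by generic_field R.
Qed.

Lemma s3_pole v : value (Kz R + (Ka R)`_3 / Kw R) v -> w != 0.
Proof.
move=> fv; apply/eqP => w0.
pole_tac fv (Kw R) (Kz R * Kw R + (Ka R)`_3) (a1%:P) (a2%:P) ('X + a3%:P) (a4%:P).
- by rewrite w0.
- by rewrite w0 polyC0 mulr0 add0r polyX_addC_neq0.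
- by generic_field R.
Qed.

(** Here a constant deformation suffices: over the denominator [z ^+ 2], the numerator is -1 at
    [z = 0]. *)
Lemma s4_pole v :
  value (- Kw R + 2 * (Ka R)`_4 / Kz R - 1 / Kz R ^+ 2) v -> z != 0.
Proof.
move=> fv; apply/eqP => z0.
pole_tac fv (Kz R * Kz R) (- Kw R * (Kz R * Kz R) + 2 * (Ka R)`_4 * Kz R - 1)
  (a1%:P) (a2%:P) (a3%:P) (a4%:P).
- by rewrite z0 polyC0 mulr0.
- by rewrite z0 polyC0 !mulr0 !add0r oppr_eq0 oner_eq0.
- by generic_field R.
Qed.

Lemma pi_pole_z v : value (1 / (Kt R * Kz R)) v -> z != 0.
Proof.
move=> fv; apply/eqP => z0.
pole_tac fv (Kt R * Kz R) (1 : ratfun R) (a1%:P) (a2%:P) (a3%:P) (a4%:P).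
- by rewrite z0 polyC0 mulr0.
- exact: oner_neq0.
- by generic_field R.
Qed.

Lemma pi_pole_x v : value (1 / (Kt R * Kx R)) v -> x != 0.
Proof.
move=> fv; apply/eqP => x0.
pole_tac fv (Kt R * Kx R) (1 : ratfun R) (a1%:P) (a2%:P) (a3%:P) (a4%:P).
- by rewrite x0 polyC0 mulr0.
- exact: oner_neq0.
- by generic_field R.
Qed.
End Poles.

(** * The criterion applied to the six transformations *)

Section BacklundGenerators.
Variable R : realType.
Implicit Type a : 5.-tuple (Cplx R).

Lemma value_Ka0_admissible a (x y z w t : Cplx R) : admissible a ->
  fvalue idfun (coordinates x y z w t a`_1 a`_2 a`_3 a`_4) (Ka R)`_0 a`_0.
Proof.
move=> adm; apply: fvalue_eq (value_Ka0 _ _ _ _ _ _ _ _ _ _) _.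
by rewrite -adm; ring.
Qed.

(** Unlike in [fvalue_auto], the value of [alpha_0] is taken from a hypothesis, so that it is the
    given parameter itself. *)
Ltac value_auto :=
  eapply fvalue_eq;
  [repeat lazymatch goal with
   | |- fvalue _ _ (tval (Ka _))`_0 _ => eassumption
   | _ => fvalue_step
   end|].
(** Three goals remain: the denominators are nonzero, the transformed components have the stated
    values, and these satisfy the transformed flow. *)
Ltac backlund_tac :=
  [> by rewrite ?mulrNN mulr1
  | by move=> a; rewrite /admissible /= => <-; ring
  | let adm := fresh in move=> a x y z w t adm value;
    have value0 := value_Ka0_admissible x y z w t adm;
    split; [..|split]; value_auto; rewrite ?mulN1r ?mul1r //
  | | | ].

Lemma Backlund_s0 : Backlund (tr_s0 R).
Proof.
apply: (@Backlund_criterion R (-1) _ _ _ _ _ _ _ _ _ _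
  (fun a => [tuple - a`_0; a`_1 + 2 * a`_0; a`_2; a`_3; a`_4])
  (fun _ _ _ _ => True)
  (fun _ x _ _ _ _ => x) (fun _ _ y _ _ t => y - t)
  (fun _ _ _ z _ _ => z) (fun _ _ _ _ w _ => w)); backlund_tac.
- by [].
- by move=> a x y z w t t0 _ value; split; value_auto.
- by move=> a x y z w t adm t0 _ fl F; rewrite (mulN1r t); apply: flow_s0.
Qed.

Lemma Backlund_s1 : Backlund (tr_s1 R).
Proof.
apply: (@Backlund_criterion R 1 _ _ _ _ _ _ _ _ _ _
  (fun a => [tuple a`_0 + a`_1; - a`_1; a`_2 + a`_1; a`_3; a`_4])
  (fun _ y _ _ => y != 0)
  (fun a x y _ _ _ => x + a`_1 / y) (fun _ _ y _ _ _ => y)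
  (fun _ _ _ z _ _ => z) (fun _ _ _ _ w _ => w)); backlund_tac.
- by move=> a x y z w t vx vy vz vw adm t0 value /s1_pole.
- by move=> a x y z w t t0 y0 value; split; value_auto.
- by move=> a x y z w t adm t0 y0 fl F; rewrite (mul1r t); apply: flow_s1.
Qed.

Lemma Backlund_s2 : Backlund (tr_s2 R).
Proof.
apply: (@Backlund_criterion R 1 _ _ _ _ _ _ _ _ _ _
  (fun a => [tuple a`_0; a`_1 + a`_2; - a`_2; a`_3 + a`_2; a`_4])
  (fun x _ z _ => x - z != 0)
  (fun _ x _ _ _ _ => x) (fun a x y z _ _ => y - a`_2 / (x - z))
  (fun _ _ _ z _ _ => z) (fun a x _ z w _ => w + a`_2 / (x - z))); backlund_tac.
- by move=> a x y z w t vx vy vz vw adm t0 value _ /s2_pole.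
- by move=> a x y z w t t0 xz0 value; split; value_auto.
- by move=> a x y z w t adm t0 xz0 fl F; rewrite (mul1r t); apply: flow_s2.
Qed.

Lemma Backlund_s3 : Backlund (tr_s3 R).
Proof.
apply: (@Backlund_criterion R 1 _ _ _ _ _ _ _ _ _ _
  (fun a => [tuple a`_0; a`_1; a`_2 + a`_3; - a`_3; a`_4 + a`_3])
  (fun _ _ _ w => w != 0)
  (fun _ x _ _ _ _ => x) (fun _ _ y _ _ _ => y)
  (fun a _ _ z w _ => z + a`_3 / w) (fun _ _ _ _ w _ => w)); backlund_tac.
- by move=> a x y z w t vx vy vz vw adm t0 value _ _ /s3_pole.
- by move=> a x y z w t t0 w0 value; split; value_auto.
- by move=> a x y z w t adm t0 w0 fl F; rewrite (mul1r t); apply: flow_s3.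
Qed.

Lemma Backlund_s4 : Backlund (tr_s4 R).
Proof.
apply: (@Backlund_criterion R (-1) _ _ _ _ _ _ _ _ _ _
  (fun a => [tuple a`_0; a`_1; a`_2; a`_3 + 2 * a`_4; - a`_4])
  (fun _ _ z _ => z != 0)
  (fun _ x _ _ _ _ => - x) (fun _ _ y _ _ _ => - y) (fun _ _ _ z _ _ => - z)
  (fun a _ _ z w _ => - w + 2 * a`_4 / z - 1 / z ^+ 2)); backlund_tac.
- by move=> a x y z w t vx vy vz vw adm t0 value _ _ _ /s4_pole.
- by move=> a x y z w t t0 z0 value; split; value_auto; rewrite ?expf_neq0.
- by move=> a x y z w t adm t0 z0 fl F; rewrite (mulN1r t); apply: flow_s4.
Qed.

Lemma Backlund_pi : Backlund (tr_pi R).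
Proof.
apply: (@Backlund_criterion R 1 _ _ _ _ _ _ _ _ _ _
  (fun a => [tuple a`_4; a`_3; a`_2; a`_1; a`_0])
  (fun x _ z _ => x != 0 /\ z != 0)
  (fun _ _ _ z _ t => 1 / (t * z)) (fun a _ _ z w t => - (t * (z * w + a`_3) * z))
  (fun _ x _ _ _ t => 1 / (t * x)) (fun a x y _ _ t => - (t * (x * y + a`_1) * x)));
  backlund_tac.
- by move=> a x y z w t vx vy vz vw adm t0 value /pi_pole_z z0 _ /pi_pole_x.
- by move=> a x y z w t t0 [x0 z0] value; split; value_auto; rewrite ?mulf_neq0.
- move=> a x y z w t adm t0 [x0 z0] fl F; rewrite (mul1r t).
  exact: (flow_pi adm t0 fl x0 z0).
Qed.

Lemma Backlund_s (i : 'I_5) : Backlund (tr_s R i).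
Proof.
case: i => [[|[|[|[|[|//]]]]] ?]; rewrite /tr_s (tnth_nth (tr_s0 R)).
- exact: Backlund_s0.
- exact: Backlund_s1.
- exact: Backlund_s2.
- exact: Backlund_s3.
- exact: Backlund_s4.
Qed.
End BacklundGenerators.

Theorem theorem6p1 (R : realType) :
  [/\ forall i : 'I_5, Backlund (tr_s R i),
      Backlund (tr_pi R)
    & exists (S : 'I_5 -> {rmorphism ratfun R -> ratfun R})
             (P : {rmorphism ratfun R -> ratfun R}),
      [/\ forall i : 'I_5, automorphism_of (tr_s R i) (S i),
          automorphism_of (tr_pi R) P,
          forall u v : seq 'I_5,
            word_act S u =1 word_act S v <-> D52_eq u v,
          P \o P =1 idfun
        & forall i : 'I_5, P \o S i =1 S (rev_ord i) \o P]].
Proof.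
split; [exact: Backlund_s|exact: Backlund_pi|exact: weyl_group_realization].
Qed.
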